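(* Consider an $M\times M$ input-queued switch with arrival rate matrix $\lambda\in\mathbb R_+^{M\times M}$ with $\lambda>0$ componentwise and $\sum_j\lambda_{\hat\imath j}=1$, $\sum_i\lambda_{i\hat\jmath}=1$ for all $\hat\imath,\hat\jmath$. Then $\lambda$ satisfies the complete loading condition and $\Xi(\lambda)=\{r_{\hat\imath}:1\le\hat\imath\le M\}\cup\{c_{\hat\jmath}:1\le\hat\jmath\le M\}$, where $(r_{\hat\imath})_{ij}=1_{i=\hat\imath}$ and $(c_{\hat\jmath})_{ij}=1_{j=\hat\jmath}$. Let $W(q)=(\xi\cdot q)_{\xi\in\Xi(\lambda)}\in\mathbb R_+^{2M}$. Then: (i) if $w$ is in the relative interior of $\{W(q):q\in\mathbb R_+^{M\times M}\}$, then $w\in\{W(q):q\in\mathcal I(\alpha)\}$ for all sufficiently small $\alpha>0$; (ii) for $M=2$, the set $\{W(q):q\in\mathcal I(\alpha)\}$ is strictly increasing as $\alpha$ decreases, i.e. for $0<\alpha<\beta$ it is a strict superset of $\{W(q):q\in\mathcal I(\beta)\}$.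
   Context: Input-queued switch: $N=M^2$ queues indexed by $(i,j)$, schedule set $\mathcal S$ = all $M\times M$ permutation matrices; for matrices, $x\cdot y=\sum_{i,j}x_{ij}y_{ij}$. $\langle\mathcal S\rangle$ convex hull; $\Lambda=\{\lambda\ge0:\lambda\le\sigma$ for some $\sigma\in\langle\mathcal S\rangle\}$. $E$ = extreme points of $\{\xi\ge0:\max_\pi\xi\cdot\pi\le1\}$, $\mathcal S^*$ its maximal elements (componentwise order), $\Xi(\lambda)=\{\xi\in\mathcal S^*:\xi\cdot\lambda=1\}$. Complete loading: $\lambda\in\Lambda$ and $\mathbf 1/\max_{\pi}\mathbf 1\cdot\pi$ is in the convex hull of $\Xi(\lambda)$. MW-$\alpha$ corresponds to $f(x)=x^\alpha$; $L_\alpha(q)=\sum_{ij}q_{ij}^{1+\alpha}/(1+\alpha)$. The lifting map $\Delta_\alpha(q)$ is the unique minimizer of $L_\alpha(r)$ over $r\ge0$ subject to $\xi\cdot r\ge\xi\cdot q$ for all $\xi\in\Xi(\lambda)$ and $r_{ij}\le q_{ij}$ whenever $\lambda_{ij}=0$; $\mathcal I(\alpha)=\{q\in\mathbb R_+^{M\times M}:\Delta_\alpha(q)=q\}$ is the set of invariant states. *)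

(* Defs.v *)
From Stdlib Require Import Reals Lra List Arith.
Open Scope R_scope.

(* M x M real matrices, represented as functions; only indices < M matter. *)
Definition mat := nat -> nat -> R.

Fixpoint rsum (n : nat) (f : nat -> R) : R :=
  match n with O => 0 | S k => rsum k f + f k end.

Definition dot (M : nat) (x y : mat) : R :=
  rsum M (fun i => rsum M (fun j => x i j * y i j)).

Definition meq (M : nat) (x y : mat) : Prop :=
  forall i j, (i < M)%nat -> (j < M)%nat -> x i j = y i j.
Definition mnonneg (M : nat) (x : mat) : Prop :=
  forall i j, (i < M)%nat -> (j < M)%nat -> 0 <= x i j.
Definition mle (M : nat) (x y : mat) : Prop :=
  forall i j, (i < M)%nat -> (j < M)%nat -> x i j <= y i j.

Definition is_perm (M : nat) (p : nat -> nat) : Prop :=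
  (forall i, (i < M)%nat -> (p i < M)%nat) /\
  (forall i j, (i < M)%nat -> (j < M)%nat -> p i = p j -> i = j).
Definition perm_mx (p : nat -> nat) : mat :=
  fun i j => if Nat.eqb (p i) j then 1 else 0.
Definition is_sched (M : nat) (s : mat) : Prop :=
  exists p, is_perm M p /\ meq M s (perm_mx p).

Definition comb (l : list (R * mat)) : mat :=
  fun i j => fold_right (fun tp acc => acc + fst tp * snd tp i j) 0 l.
Definition wsum {A : Type} (l : list (R * A)) : R :=
  fold_right (fun tp acc => acc + fst tp) 0 l.
Definition in_hull (M : nat) (P : mat -> Prop) (x : mat) : Prop :=
  exists l : list (R * mat),
    Forall (fun tp => 0 <= fst tp /\ P (snd tp)) l /\
    wsum l = 1 /\ meq M x (comb l).

Definition in_Lambda (M : nat) (lam : mat) : Prop :=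
  mnonneg M lam /\ exists sigma, in_hull M (is_sched M) sigma /\ mle M lam sigma.

Definition in_dualP (M : nat) (xi : mat) : Prop :=
  mnonneg M xi /\ forall s, is_sched M s -> dot M xi s <= 1.

Definition extreme (M : nat) (P : mat -> Prop) (x : mat) : Prop :=
  P x /\ forall a b t, P a -> P b -> 0 < t < 1 ->
    meq M x (fun i j => t * a i j + (1 - t) * b i j) -> meq M a b.

Definition in_E (M : nat) (xi : mat) : Prop := extreme M (in_dualP M) xi.
Definition in_Sstar (M : nat) (xi : mat) : Prop :=
  in_E M xi /\ forall eta, in_E M eta -> mle M xi eta -> meq M eta xi.

Definition in_Xi (M : nat) (lam xi : mat) : Prop :=
  in_Sstar M xi /\ dot M xi lam = 1.

Definition is_max_sched_val (M : nat) (x : mat) (m : R) : Prop :=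
  (exists s, is_sched M s /\ dot M x s = m) /\
  (forall s, is_sched M s -> dot M x s <= m).

Definition ones : mat := fun _ _ => 1.

Definition complete_loading (M : nat) (lam : mat) : Prop :=
  in_Lambda M lam /\
  forall m, is_max_sched_val M ones m -> in_hull M (in_Xi M lam) (fun _ _ => 1 / m).

(* x^a for x >= 0 (0^a = 0 for a > 0); Stdlib's Rpower 0 a is 1, so patch it *)
Definition rpow (x a : R) : R := if Rle_dec x 0 then 0 else Rpower x a.

Definition Lfun (M : nat) (alpha : R) (q : mat) : R :=
  rsum M (fun i => rsum M (fun j => rpow (q i j) (1 + alpha) / (1 + alpha))).

Definition lift_feasible (M : nat) (lam q r : mat) : Prop :=
  mnonneg M r /\
  (forall xi, in_Xi M lam xi -> dot M xi r >= dot M xi q) /\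
  (forall i j, (i < M)%nat -> (j < M)%nat -> lam i j = 0 -> r i j <= q i j).

Definition is_lift (M : nat) (alpha : R) (lam q r : mat) : Prop :=
  lift_feasible M lam q r /\
  (forall r', lift_feasible M lam q r' -> Lfun M alpha r <= Lfun M alpha r') /\
  (forall r', lift_feasible M lam q r' -> Lfun M alpha r' <= Lfun M alpha r ->
              meq M r' r).

Definition invariant (M : nat) (alpha : R) (lam q : mat) : Prop :=
  mnonneg M q /\ is_lift M alpha lam q q.

Definition row_ind (i0 : nat) : mat := fun i _ => if Nat.eqb i i0 then 1 else 0.
Definition col_ind (j0 : nat) : mat := fun _ j => if Nat.eqb j j0 then 1 else 0.

(* enumeration of Xi(lambda) = {r_0..r_{M-1}, c_0..c_{M-1}} used to index W *)
Definition xi_enum (M k : nat) : mat :=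
  if Nat.ltb k M then row_ind k else col_ind (k - M).

Definition Wmap (M : nat) (q : mat) : nat -> R := fun k => dot M (xi_enum M k) q.

Definition veq (n : nat) (v w : nat -> R) : Prop := forall k, (k < n)%nat -> v k = w k.

Definition Wcone (M : nat) (w : nat -> R) : Prop :=
  exists q, mnonneg M q /\ veq (2 * M) (Wmap M q) w.

Definition Wset (M : nat) (lam : mat) (alpha : R) (w : nat -> R) : Prop :=
  exists q, invariant M alpha lam q /\ veq (2 * M) (Wmap M q) w.

Definition vcomb (l : list (R * (nat -> R))) : nat -> R :=
  fun k => fold_right (fun tp acc => acc + fst tp * snd tp k) 0 l.
Definition in_aff (n : nat) (P : (nat -> R) -> Prop) (v : nat -> R) : Prop :=
  exists l : list (R * (nat -> R)),
    Forall (fun tp => P (snd tp)) l /\ wsum l = 1 /\ veq n v (vcomb l).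
Definition rel_interior (n : nat) (P : (nat -> R) -> Prop) (w : nat -> R) : Prop :=
  P w /\ exists eps, 0 < eps /\
    forall v, in_aff n P v -> (forall k, (k < n)%nat -> Rabs (v k - w k) < eps) -> P v.

(* Main.v *)
(* Subtracting a small multiple of a permutation [p] from [lambda > 0] leaves a multiple of a doubly
   stochastic matrix, so Birkhoff's theorem shows that every [xi] in [Xi(lambda)] has [xi . p = 1]
   for all [p].  Exchanging two values of [p] gives [xi_ij + xi_kl = xi_il + xi_kj], i.e.
   [xi_ij = u_i + v_j] with [u, v >= 0], and extremality leaves only row and column indicators.

   By the same exchange argument, [q] is invariant iff
   [q_ij^alpha + q_kl^alpha = q_il^alpha + q_kj^alpha] for all indices (the KKT conditions).
   For (i), minimise [L_alpha] over the nonnegative matrices with the row and column sums prescribed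
   by [w].  A zero entry of the minimiser could be raised against two entries bounded below, with
   first-order effect of the form [x^alpha - y^alpha - z^alpha], close to [1 - 1 - 1] for small
   [alpha]; so the minimiser is positive and satisfies the exchange equations.
   For (ii), the 2 x 2 matrices with given sums form a segment; the exchange equation for [alpha] is
   solved on it by the intermediate value theorem, with the signs at the end points coming from
   [z^beta <= x^beta + y^beta -> z^alpha <= x^alpha + y^alpha].  The matrix
   [(1, 0; 2^(1/alpha), 1)] shows strictness. *)
Require Import Defs.
From Stdlib Require Import Reals.
From Stdlib Require Import Lra Lia List Arith Classical ClassicalEpsilon FinFun.
Open Scope R_scope.

(** * Finite sums, minima and lower bounds *)

Lemma rsum_ext (n : nat) (f g : nat -> R) :
  (forall i, (i < n)%nat -> f i = g i) -> rsum n f = rsum n g.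
Proof.
  induction n as [|n IH]; intros H; simpl; [reflexivity|].
  rewrite IH by auto with arith. rewrite H by lia. reflexivity.
Qed.

Lemma rsum_plus (n : nat) (f g : nat -> R) :
  rsum n (fun i => f i + g i) = rsum n f + rsum n g.
Proof. induction n as [|n IH]; simpl; [lra|rewrite IH; lra]. Qed.

Lemma rsum_scal (n : nat) (c : R) (f : nat -> R) :
  rsum n (fun i => c * f i) = c * rsum n f.
Proof. induction n as [|n IH]; simpl; [lra|rewrite IH; lra]. Qed.

Lemma rsum_minus (n : nat) (f g : nat -> R) :
  rsum n (fun i => f i - g i) = rsum n f - rsum n g.
Proof. induction n as [|n IH]; simpl; [lra|rewrite IH; lra]. Qed.

Lemma rsum_const (n : nat) (c : R) : rsum n (fun _ => c) = INR n * c.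
Proof. induction n as [|n IH]; [simpl; lra|]. rewrite S_INR; simpl; rewrite IH; lra. Qed.

Lemma rsum_zero (n : nat) (f : nat -> R) :
  (forall i, (i < n)%nat -> f i = 0) -> rsum n f = 0.
Proof.
  intros H. rewrite (rsum_ext n f (fun _ => 0)) by exact H. rewrite rsum_const; lra.
Qed.

Lemma rsum_le (n : nat) (f g : nat -> R) :
  (forall i, (i < n)%nat -> f i <= g i) -> rsum n f <= rsum n g.
Proof.
  induction n as [|n IH]; intros H; simpl; [lra|].
  assert (f n <= g n) by (apply H; lia).
  assert (rsum n f <= rsum n g) by (apply IH; auto with arith). lra.
Qed.

Lemma rsum_nonneg (n : nat) (f : nat -> R) :
  (forall i, (i < n)%nat -> 0 <= f i) -> 0 <= rsum n f.
Proof.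
  intros H. rewrite <- (rsum_zero n (fun _ => 0)) by reflexivity. now apply rsum_le.
Qed.

Lemma rsum_term_le (n : nat) (f : nat -> R) (k : nat) :
  (forall i, (i < n)%nat -> 0 <= f i) -> (k < n)%nat -> f k <= rsum n f.
Proof.
  induction n as [|n IH]; intros H Hk; simpl; [lia|].
  assert (0 <= f n) by (apply H; lia).
  assert (0 <= rsum n f) by (apply rsum_nonneg; auto with arith).
  destruct (Nat.eq_dec k n) as [->|]; [lra|].
  assert (f k <= rsum n f) by (apply IH; [auto with arith|lia]). lra.
Qed.

Lemma rsum_swap (n m : nat) (f : nat -> nat -> R) :
  rsum n (fun i => rsum m (fun j => f i j)) = rsum m (fun j => rsum n (fun i => f i j)).
Proof.
  induction n as [|n IH]; simpl.
  - now rewrite rsum_zero.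
  - now rewrite IH, rsum_plus.
Qed.

Lemma rsum_delta (n k : nat) (f : nat -> R) :
  (k < n)%nat -> rsum n (fun i => if Nat.eqb i k then f i else 0) = f k.
Proof.
  induction n as [|n IH]; intros Hk; simpl; [lia|].
  destruct (Nat.eqb_spec n k) as [->|Hn].
  - rewrite rsum_zero; [lra|]. intros i Hi. destruct (Nat.eqb_spec i k); [lia|reflexivity].
  - rewrite IH by lia. lra.
Qed.

Lemma pos_lower_bound (n : nat) (f : nat -> R) :
  (forall i, (i < n)%nat -> 0 < f i) ->
  exists e, 0 < e /\ forall i, (i < n)%nat -> e <= f i.
Proof.
  induction n as [|n IH]; intros H.
  - exists 1. split; [lra|intros; lia].
  - destruct IH as [e [He Hf]]; [auto with arith|].
    exists (Rmin e (f n)). split; [apply Rmin_glb_lt; auto with arith|].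
    intros i Hi. destruct (Nat.eq_dec i n) as [->|]; [apply Rmin_r|].
    apply Rle_trans with e; [apply Rmin_l|apply Hf; lia].
Qed.

Lemma argmin (n : nat) (f : nat -> R) :
  (1 <= n)%nat -> exists k, (k < n)%nat /\ forall i, (i < n)%nat -> f k <= f i.
Proof.
  induction n as [|n IH]; intros Hn; [lia|].
  destruct (Nat.eq_dec n 0) as [->|].
  - exists O. split; [lia|]. intros i Hi. replace i with O by lia. lra.
  - destruct IH as [k [Hk H]]; [lia|].
    destruct (Rle_lt_dec (f k) (f n)).
    + exists k. split; [lia|]. intros i Hi.
      destruct (Nat.eq_dec i n) as [->|]; [lra|apply H; lia].
    + exists n. split; [lia|]. intros i Hi.
      destruct (Nat.eq_dec i n) as [->|]; [lra|].
      assert (f k <= f i) by (apply H; lia). lra.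
Qed.

(** The largest term is at least the average; it is found as the minimum of [- f]. *)
Lemma large_term (n : nat) (f : nat -> R) (c : R) : (1 <= n)%nat -> c <= rsum n f ->
  exists k, (k < n)%nat /\ c / INR n <= f k.
Proof.
  intros Hn Hc. destruct (argmin n (fun i => - f i) Hn) as [k [Hk H]].
  exists k. split; [exact Hk|].
  assert (0 < INR n) by (apply lt_0_INR; lia).
  assert (Hs : rsum n f <= INR n * f k).
  { rewrite <- rsum_const. apply rsum_le. intros i Hi. specialize (H i Hi). lra. }
  apply Rmult_le_reg_r with (INR n); [assumption|]. unfold Rdiv.
  rewrite Rmult_assoc, Rinv_l by lra. lra.
Qed.

(** * Inner products with row, column and unit matrices *)

Lemma dot_ext (M : nat) (x x' y y' : mat) :
  meq M x x' -> meq M y y' -> dot M x y = dot M x' y'.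
Proof.
  intros Hx Hy. apply rsum_ext; intros i Hi. apply rsum_ext; intros j Hj.
  now rewrite Hx, Hy.
Qed.

Lemma meq_refl (M : nat) (x : mat) : meq M x x.
Proof. intros i j _ _; reflexivity. Qed.

Lemma dot_comm (M : nat) (x y : mat) : dot M x y = dot M y x.
Proof. apply rsum_ext; intros; apply rsum_ext; intros; ring. Qed.

Lemma dot_lin (M : nat) (x y z : mat) (c : R) :
  dot M x (fun i j => y i j + c * z i j) = dot M x y + c * dot M x z.
Proof.
  unfold dot. rewrite <- rsum_scal, <- rsum_plus. apply rsum_ext; intros.
  rewrite <- rsum_scal, <- rsum_plus. apply rsum_ext; intros; ring.
Qed.

Lemma dot_row (M : nat) (y : mat) (a : nat) :
  (a < M)%nat -> dot M (row_ind a) y = rsum M (fun j => y a j).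
Proof.
  intros Ha. unfold dot, row_ind.
  rewrite <- (rsum_delta M a (fun i => rsum M (fun j => y i j))) by exact Ha.
  apply rsum_ext; intros i _. destruct (Nat.eqb i a).
  - apply rsum_ext; intros; ring.
  - apply rsum_zero; intros; ring.
Qed.

Lemma dot_col (M : nat) (y : mat) (b : nat) :
  (b < M)%nat -> dot M (col_ind b) y = rsum M (fun i => y i b).
Proof.
  intros Hb. unfold dot, col_ind. apply rsum_ext; intros i _.
  rewrite <- (rsum_delta M b (fun j => y i j)) by exact Hb.
  apply rsum_ext; intros j _. destruct (Nat.eqb j b); ring.
Qed.

(** The pairing sees [y] only through its row and column sums, which lets [u] and [v] act as
    multipliers for the margin constraints. *)
Lemma dot_rank1 (M : nat) (u v : nat -> R) (y : mat) :
  dot M (fun i j => u i + v j) y =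
  rsum M (fun i => u i * dot M (row_ind i) y) + rsum M (fun j => v j * dot M (col_ind j) y).
Proof.
  rewrite (rsum_ext M (fun i => u i * _) (fun i => rsum M (fun j => u i * y i j)))
    by (intros; rewrite rsum_scal, dot_row by assumption; reflexivity).
  rewrite (rsum_ext M (fun j => v j * _) (fun j => rsum M (fun i => v j * y i j)))
    by (intros; rewrite rsum_scal, dot_col by assumption; reflexivity).
  rewrite (rsum_swap M M (fun j i => v j * y i j)), <- rsum_plus.
  apply rsum_ext; intros i _. rewrite <- rsum_plus. apply rsum_ext; intros; ring.
Qed.

Definition unit_mx (a b : nat) : mat :=
  fun i j => if Nat.eqb i a then (if Nat.eqb j b then 1 else 0) else 0.

Lemma dot_unit (M : nat) (x : mat) (a b : nat) :
  (a < M)%nat -> (b < M)%nat -> dot M x (unit_mx a b) = x a b.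
Proof.
  intros Ha Hb. unfold dot, unit_mx.
  rewrite <- (rsum_delta M a (fun i => x i b)) by exact Ha.
  apply rsum_ext; intros i _. destruct (Nat.eqb i a).
  - rewrite <- (rsum_delta M b (fun j => x i j)) by exact Hb.
    apply rsum_ext; intros j _. destruct (Nat.eqb j b); ring.
  - apply rsum_zero; intros; ring.
Qed.

(** * Permutation matrices *)

Lemma dot_perm (M : nat) (x : mat) (p : nat -> nat) :
  is_perm M p -> dot M x (perm_mx p) = rsum M (fun i => x i (p i)).
Proof.
  intros [Hp _]. unfold dot, perm_mx. apply rsum_ext; intros i Hi.
  rewrite <- (rsum_delta M (p i) (fun j => x i j)) by auto.
  apply rsum_ext; intros j _. rewrite Nat.eqb_sym. destruct (Nat.eqb j (p i)); ring.
Qed.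

Lemma perm_row_sum (M : nat) (p : nat -> nat) (i : nat) :
  is_perm M p -> (i < M)%nat -> rsum M (fun j => perm_mx p i j) = 1.
Proof.
  intros [Hp _] Hi. rewrite <- (rsum_delta M (p i) (fun _ => 1)) by auto.
  apply rsum_ext; intros j _. unfold perm_mx. now rewrite Nat.eqb_sym.
Qed.

Lemma perm_col_sum (M : nat) (p : nat -> nat) (j : nat) :
  is_perm M p -> (j < M)%nat -> rsum M (fun i => perm_mx p i j) = 1.
Proof.
  intros [Hp Hinj] Hj.
  (* An injective self-map of a finite set is onto, so exactly one row [k] hits column [j]. *)
  destruct (proj1 (bInjective_bSurjective Hp) Hinj j Hj) as [k [Hk Hkj]].
  rewrite <- (rsum_delta M k (fun _ => 1)) by exact Hk.
  apply rsum_ext; intros i Hi. unfold perm_mx.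
  destruct (Nat.eqb_spec (p i) j) as [E|E], (Nat.eqb_spec i k) as [F|F]; try reflexivity.
  - elim F. apply Hinj; congruence.
  - congruence.
Qed.

(** Besides exchanging two values of a permutation, it serves as a permutation through a prescribed
    entry, since it sends [a] to [b]. *)
Definition swap (a b i : nat) : nat :=
  if Nat.eqb i a then b else if Nat.eqb i b then a else i.

Lemma swap_perm (M a b : nat) : (a < M)%nat -> (b < M)%nat -> is_perm M (swap a b).
Proof.
  intros Ha Hb. unfold swap. split; intros i.
  - destruct (Nat.eqb_spec i a), (Nat.eqb_spec i b); lia.
  - intros j _ _.
    destruct (Nat.eqb_spec i a), (Nat.eqb_spec i b), (Nat.eqb_spec j a), (Nat.eqb_spec j b); lia.
Qed.

Lemma swap_l (a b : nat) : swap a b a = b.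
Proof. unfold swap. now rewrite Nat.eqb_refl. Qed.

Lemma comp_perm (M : nat) (p r : nat -> nat) :
  is_perm M p -> is_perm M r -> is_perm M (fun i => p (r i)).
Proof.
  intros [Hp Ip] [Hr Ir]. split; [auto|]. intros i j Hi Hj E. apply Ir, Ip; auto.
Qed.

Lemma perm_sched (M : nat) (p : nat -> nat) : is_perm M p -> is_sched M (perm_mx p).
Proof. intros Hp. exists p. split; [exact Hp|apply meq_refl]. Qed.

Lemma perm_through (M a b c d : nat) :
  (a < M)%nat -> (b < M)%nat -> (c < M)%nat -> (d < M)%nat -> a <> c -> b <> d ->
  exists p, is_perm M p /\ p a = b /\ p c = d.
Proof.
  intros Ha Hb Hc Hd Hac Hbd.
  assert (Hs := swap_perm M a b Ha Hb).
  assert (Hne : swap a b c <> b).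
  { intros E. apply Hac. apply Hs; auto. now rewrite swap_l. }
  (* The inner transposition sends [a] to [b]; the outer one carries the image of [c] to [d] and
     fixes [b], which differs from both points it exchanges. *)
  exists (fun i => swap (swap a b c) d (swap a b i)). split; [|split].
  - apply comp_perm; [|exact Hs]. apply swap_perm; [apply Hs|]; assumption.
  - rewrite swap_l. unfold swap at 1.
    destruct (Nat.eqb_spec b (swap a b c)), (Nat.eqb_spec b d); congruence.
  - apply swap_l.
Qed.

(** * Hall's theorem and Birkhoff's theorem *)

(** Classical indicator: membership is an arbitrary [Prop], so that Hall's condition can range over
    all sets of rows. *)
Definition ind (P : Prop) : nat := if excluded_middle_informative P then 1%nat else 0%nat.

Fixpoint card (n : nat) (P : nat -> Prop) : nat :=
  match n with O => O | S k => (card k P + ind (P k))%nat end.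

Lemma card_union_le (n : nat) (P Q S : nat -> Prop) :
  (forall i, (i < n)%nat -> P i -> Q i \/ S i) -> (card n P <= card n Q + card n S)%nat.
Proof.
  induction n as [|n IH]; intros H; simpl; [lia|].
  assert (card n P <= card n Q + card n S)%nat by (apply IH; auto with arith).
  assert (Hn := H n (Nat.lt_succ_diag_r n)). unfold ind.
  repeat destruct excluded_middle_informative; try lia; tauto.
Qed.

Lemma card_mono (n : nat) (P Q : nat -> Prop) :
  (forall i, (i < n)%nat -> P i -> Q i) -> (card n P <= card n Q)%nat.
Proof.
  induction n as [|n IH]; intros H; simpl; [lia|].
  assert (card n P <= card n Q)%nat by (apply IH; auto with arith).
  assert (Hn := H n (Nat.lt_succ_diag_r n)). unfold ind.
  repeat destruct excluded_middle_informative; try lia; tauto.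
Qed.

Lemma card_disjoint_le (n : nat) (P Q S : nat -> Prop) :
  (forall i, (i < n)%nat -> P i -> S i) -> (forall i, (i < n)%nat -> Q i -> S i) ->
  (forall i, (i < n)%nat -> P i -> Q i -> False) ->
  (card n P + card n Q <= card n S)%nat.
Proof.
  induction n as [|n IH]; intros H1 H2 H3; simpl; [lia|].
  assert (card n P + card n Q <= card n S)%nat by (apply IH; eauto with arith).
  assert (Hn := Nat.lt_succ_diag_r n).
  specialize (H1 n Hn); specialize (H2 n Hn); specialize (H3 n Hn). unfold ind.
  repeat destruct excluded_middle_informative; try lia; tauto.
Qed.

Lemma card_pos (n : nat) (P : nat -> Prop) (i : nat) :
  (i < n)%nat -> P i -> (1 <= card n P)%nat.
Proof.
  induction n as [|n IH]; intros Hi HP; simpl; [lia|].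
  destruct (Nat.eq_dec i n) as [->|].
  - unfold ind. destruct excluded_middle_informative; [lia|tauto].
  - assert (1 <= card n P)%nat by (apply IH; [lia|exact HP]). lia.
Qed.

Lemma card_pos_inv (n : nat) (P : nat -> Prop) :
  (1 <= card n P)%nat -> exists i, (i < n)%nat /\ P i.
Proof.
  induction n as [|n IH]; simpl; intros H; [lia|].
  unfold ind in H. destruct (excluded_middle_informative (P n)) as [HP|HP].
  - exists n; auto.
  - destruct IH as [i [Hi HPi]]; [lia|]. exists i; auto.
Qed.

Lemma card_single (n k : nat) : (card n (eq k) <= 1)%nat.
Proof.
  induction n as [|n IH]; simpl; [lia|]. unfold ind.
  destruct (excluded_middle_informative (k = n)) as [->|]; [|lia].
  destruct (le_lt_dec (card n (eq n)) 0) as [|Hp]; [lia|].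
  destruct (card_pos_inv n (eq n)) as [i [Hi E]]; lia.
Qed.

Lemma INR_card (n : nat) (P : nat -> Prop) : INR (card n P) = rsum n (fun i => INR (ind (P i))).
Proof.
  induction n as [|n IH]; [reflexivity|]. simpl card. rewrite plus_INR, IH. reflexivity.
Qed.

Definition nbrs (M : nat) (r : nat -> nat -> Prop) (A : nat -> Prop) (j : nat) : Prop :=
  exists i, (i < M)%nat /\ A i /\ r i j.

(* [D] and [V] are the rows still to be matched and the columns still free; when some proper
   nonempty [A] is tight, [A] is matched inside its neighbours and [D \ A] outside them. *)
Lemma hall_restricted (M : nat) (r : nat -> nat -> Prop) (n : nat) : forall D V : nat -> Prop,
  (card M D <= n)%nat ->
  (forall A : nat -> Prop, (forall i, (i < M)%nat -> A i -> D i) ->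
     (card M A <= card M (fun j => nbrs M r A j /\ V j))%nat) ->
  exists f : nat -> nat,
    (forall i, (i < M)%nat -> D i -> (f i < M)%nat /\ V (f i) /\ r i (f i)) /\
    (forall i j, (i < M)%nat -> (j < M)%nat -> D i -> D j -> f i = f j -> i = j).
Proof.
  induction n as [|n IH]; intros D V HD Hall.
  { exists (fun i => i). split; intros i; intros; exfalso;
      assert (1 <= card M D)%nat by (apply (card_pos M D i); assumption); lia. }
  destruct (classic (exists x, (x < M)%nat /\ D x)) as [[x [Hx Dx]]|HE].
  2:{ exists (fun i => i). split; intros; exfalso; eauto. }
  destruct (classic (exists A : nat -> Prop, (forall i, (i < M)%nat -> A i -> D i) /\
      (exists a, (a < M)%nat /\ A a) /\ (exists d, (d < M)%nat /\ D d /\ ~ A d) /\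
      (card M (fun j => nbrs M r A j /\ V j) <= card M A)%nat))
    as [[A [HA [[a [Ha Aa]] [[d [Hd [Dd Ad]]] Htight]]]]|Hno].
  - destruct (IH A V) as [f [Hf If]].
    + assert (1 <= card M (eq d))%nat by (apply (card_pos M _ d); auto).
      assert (card M A + card M (eq d) <= card M D)%nat.
      { apply card_disjoint_le; [exact HA|intros; subst; assumption|intros; subst; auto]. }
      lia.
    + intros B HB. apply Hall. auto.
    + destruct (IH (fun i => D i /\ ~ A i) (fun j => V j /\ ~ nbrs M r A j)) as [g [Hg Ig]].
      * assert (1 <= card M A)%nat by (apply (card_pos M _ a); auto).
        assert (card M A + card M (fun i => D i /\ ~ A i) <= card M D)%nat.
        { apply card_disjoint_le; [exact HA|tauto|tauto]. }
        lia.
      * intros B HB.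
        (* Hall's condition for the union of [A] and [B], less the tight count for [A], leaves at
           least [card M B] neighbours of [B] outside those of [A]. *)
        assert (card M (fun i => A i \/ B i) <= card M (fun j => nbrs M r (fun i => A i \/ B i) j /\ V j))%nat.
        { apply Hall. intros i Hi [Ai|Bi]; [auto|apply HB; auto]. }
        assert (card M A + card M B <= card M (fun i => A i \/ B i))%nat.
        { apply card_disjoint_le; [tauto|tauto|]. intros i Hi Ai Bi. now apply (HB i). }
        assert (card M (fun j => nbrs M r (fun i => A i \/ B i) j /\ V j) <=
          card M (fun j => nbrs M r A j /\ V j) +
          card M (fun j => nbrs M r B j /\ V j /\ ~ nbrs M r A j))%nat.
        { apply card_union_le. intros j Hj [[i [Hi [AB Hr]]] Vj].
          destruct (classic (nbrs M r A j)) as [|HnA]; [auto|]. right.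
          split; [|auto]. exists i. split; [exact Hi|]. split; [|exact Hr].
          destruct AB; [|assumption]. elim HnA. exists i; auto. }
        lia.
      * exists (fun i => if excluded_middle_informative (A i) then f i else g i).
        assert (Hfn : forall i, (i < M)%nat -> A i -> nbrs M r A (f i)).
        { intros i Hi Ai. exists i. split; [exact Hi|]. split; [exact Ai|]. now apply Hf. }
        split.
        -- intros i Hi Di. destruct excluded_middle_informative as [Ai|Ai]; [now apply Hf|].
           destruct (Hg i Hi (conj Di Ai)) as [? [[? ?] ?]]. auto.
        -- intros i j Hi Hj Di Dj.
           destruct (excluded_middle_informative (A i)) as [Ai|Ai],
             (excluded_middle_informative (A j)) as [Aj|Aj]; intros E.
           ++ now apply If.
           ++ exfalso. apply (proj2 (proj1 (proj2 (Hg j Hj (conj Dj Aj))))). rewrite <- E. auto.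
           ++ exfalso. apply (proj2 (proj1 (proj2 (Hg i Hi (conj Di Ai))))). rewrite E. auto.
           ++ now apply Ig.
  (* No proper nonempty subset is tight: [x] is matched to any free neighbour [y]. *)
  - assert (H1 : (1 <= card M (fun j => nbrs M r (eq x) j /\ V j))%nat).
    { apply Nat.le_trans with (card M (eq x)); [now apply (card_pos M _ x)|].
      apply Hall. intros; subst; assumption. }
    destruct (card_pos_inv _ _ H1) as [y [Hy [[x' [_ [<- Hxy]]] Vy]]].
    destruct (IH (fun i => D i /\ i <> x) (fun j => V j /\ j <> y)) as [f [Hf If]].
    + assert (1 <= card M (eq x))%nat by (apply (card_pos M _ x); auto).
      assert (card M (eq x) + card M (fun i => D i /\ i <> x) <= card M D)%nat.
      { apply card_disjoint_le; [intros; subst; assumption|tauto|]. intros i _ E [_ F]. auto. }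
      lia.
    + intros A HA. destruct (le_lt_dec (card M A) 0) as [|HA1]; [lia|].
      (* A nonempty set that misses [x] is not tight, so it has a spare neighbour and can afford to
         lose [y]. *)
      assert (HS : (card M A + 1 <= card M (fun j => nbrs M r A j /\ V j))%nat).
      { apply NNPP. intros Hlt. apply Hno. exists A. split; [|split; [|split]].
        - intros i Hi Ai. now apply HA.
        - now apply card_pos_inv.
        - exists x. split; [exact Hx|]. split; [exact Dx|]. intros Ax. now apply (HA x Hx Ax).
        - lia. }
      assert (card M (fun j => nbrs M r A j /\ V j) <=
        card M (fun j => nbrs M r A j /\ V j /\ j <> y) + card M (eq y))%nat.
      { apply card_union_le. intros j _ [? ?]. destruct (Nat.eq_dec j y); auto. }
      assert (Hy1 := card_single M y). lia.
    + exists (fun i => if Nat.eq_dec i x then y else f i). split.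
      * intros i Hi Di. destruct (Nat.eq_dec i x) as [->|Hix]; [auto|].
        destruct (Hf i Hi (conj Di Hix)) as [? [[? ?] ?]]. auto.
      * intros i j Hi Hj Di Dj.
        destruct (Nat.eq_dec i x) as [->|Hix], (Nat.eq_dec j x) as [->|Hjx]; intros E.
        -- reflexivity.
        -- destruct (Hf j Hj (conj Dj Hjx)) as [? [[? ?] ?]]. congruence.
        -- destruct (Hf i Hi (conj Di Hix)) as [? [[? ?] ?]]. congruence.
        -- now apply If.
Qed.

Theorem hall (M : nat) (r : nat -> nat -> Prop) :
  (forall A : nat -> Prop, (card M A <= card M (nbrs M r A))%nat) ->
  exists p, is_perm M p /\ forall i, (i < M)%nat -> r i (p i).
Proof.
  intros H. destruct (hall_restricted M r (card M (fun _ => True)) (fun _ => True) (fun _ => True))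
    as [f [Hf If]]; [lia| |].
  - intros A _. apply Nat.le_trans with (1 := H A). apply card_mono. auto.
  - exists f. split; [split|].
    + intros i Hi. now apply Hf.
    + intros i j Hi Hj. now apply If.
    + intros i Hi. now apply Hf.
Qed.

(** A doubly stochastic matrix scaled by [c]; the scale is free because each permutation peeled off
    lowers it. *)
Definition balanced (M : nat) (c : R) (x : mat) : Prop :=
  mnonneg M x /\ (forall i, (i < M)%nat -> rsum M (fun j => x i j) = c) /\
  (forall j, (j < M)%nat -> rsum M (fun i => x i j) = c).

(** Hall's condition by double counting: the rows of [A] carry mass [c] each, all of it in columns
    neighbouring [A], and each such column holds only [c]. *)
Lemma balanced_support_perm (M : nat) (c : R) (x : mat) :
  0 < c -> balanced M c x -> exists p, is_perm M p /\ forall i, (i < M)%nat -> 0 < x i (p i).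
Proof.
  intros Hc [Hx [Hr Hcol]]. apply (hall M (fun i j => 0 < x i j)). intros A.
  apply INR_le, Rmult_le_reg_l with c; [exact Hc|]. rewrite !INR_card, <- !rsum_scal.
  rewrite (rsum_ext M _ (fun i => rsum M (fun j => INR (ind (A i)) * x i j))).
  2:{ intros i Hi. rewrite rsum_scal, Hr by exact Hi. ring. }
  rewrite rsum_swap. apply rsum_le. intros j Hj.
  unfold ind at 2. destruct excluded_middle_informative as [HN|HN].
  - rewrite <- (Hcol j Hj), Rmult_1_r. apply rsum_le. intros i Hi.
    assert (0 <= x i j) by auto. unfold ind. destruct excluded_middle_informative; simpl; lra.
  - rewrite Rmult_0_r, rsum_zero; [lra|]. intros i Hi. unfold ind.
    destruct excluded_middle_informative as [Ai|]; simpl; [|ring].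
    assert (0 <= x i j) by auto. destruct (Rle_lt_dec (x i j) 0); [lra|].
    elim HN. exists i; auto.
Qed.

Lemma balanced_sub_perm (M : nat) (c e : R) (x : mat) (p : nat -> nat) :
  balanced M c x -> is_perm M p -> (forall i, (i < M)%nat -> e <= x i (p i)) ->
  balanced M (c - e) (fun i j => x i j + (- e) * perm_mx p i j).
Proof.
  intros [Hx [Hr Hcol]] Hp He. split; [|split].
  - intros i j Hi Hj. assert (0 <= x i j) by auto. unfold perm_mx.
    destruct (Nat.eqb_spec (p i) j) as [<-|]; [|lra]. specialize (He i Hi). lra.
  - intros i Hi. rewrite rsum_plus, rsum_scal, perm_row_sum, Hr by assumption. ring.
  - intros j Hj. rewrite rsum_plus, rsum_scal, perm_col_sum, Hcol by assumption. ring.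
Qed.

(* Induction on a bound [n] for the number of positive entries. *)
Lemma birkhoff_aux (M n : nat) (HM : (1 <= M)%nat) : forall (c : R) (x : mat),
  balanced M c x ->
  rsum M (fun i => rsum M (fun j => INR (ind (0 < x i j)))) <= INR n ->
  exists l : list (R * mat), Forall (fun tp => 0 <= fst tp /\ is_sched M (snd tp)) l /\
    wsum l = c /\ meq M x (comb l).
Proof.
  induction n as [|n IH]; intros c x Hb Hn.
  all: assert (Hx := proj1 Hb).
  all: assert (Hc : 0 <= c)
    by (rewrite <- (proj1 (proj2 Hb) O) by lia; apply rsum_nonneg; intros; apply Hx; lia).
  all: destruct (Req_dec c 0) as [->|Hc0];
    [exists nil; split; [constructor|]; split; [reflexivity|]; intros i j Hi Hj;
     assert (H0 : x i j <= 0) by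
       (rewrite <- (proj1 (proj2 Hb) i Hi); apply (rsum_term_le M (fun j => x i j)); auto);
     specialize (Hx i j Hi Hj); simpl; lra|].
  all: destruct (balanced_support_perm M c x) as [p [Hp Hpos]]; [lra|exact Hb|].
  all: assert (Hind : forall i j, 0 <= INR (ind (0 < x i j))) by (intros; apply pos_INR).
  - exfalso. simpl in Hn.
    assert (INR (ind (0 < x O (p O))) <= 0).
    { apply Rle_trans with (2 := Hn).
      apply Rle_trans with (rsum M (fun j => INR (ind (0 < x O j)))).
      - apply (rsum_term_le M (fun j => INR (ind (0 < x O j)))); [auto|apply Hp; lia].
      - apply (rsum_term_le M (fun i => rsum M (fun j => INR (ind (0 < x i j))))); [|lia].
        intros; apply rsum_nonneg; auto. }
    assert (0 < x O (p O)) by (apply Hpos; lia).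
    unfold ind in *. destruct excluded_middle_informative; simpl in *; [lra|tauto].
  (* Subtracting [p] with the smallest entry along it as weight keeps the matrix nonnegative and
     kills the entry [(k, p k)]. *)
  - destruct (argmin M (fun i => x i (p i)) HM) as [k [Hk Hmin]].
    set (e := x k (p k)) in *.
    assert (He : 0 < e) by (apply Hpos; exact Hk).
    assert (Hb' := balanced_sub_perm M c e x p Hb Hp Hmin).
    set (y := fun i j => x i j + - e * perm_mx p i j) in *.
    destruct (IH (c - e) y Hb') as [l [Hl [Hw Hm]]].
    (* [unit_mx k (p k)] accounts for the lost entry: summed over all positions, this bound lowers
       the count by one. *)
    + assert (Hle : forall i j, (i < M)%nat -> (j < M)%nat ->
        INR (ind (0 < y i j)) + unit_mx k (p k) i j <= INR (ind (0 < x i j))).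
      { intros i j Hi Hj. unfold y, unit_mx, perm_mx.
        destruct (Nat.eqb_spec i k) as [->|Hik].
        - destruct (Nat.eqb_spec j (p k)) as [->|Hjk].
          + rewrite Nat.eqb_refl. fold e. unfold ind.
            repeat destruct excluded_middle_informative; simpl; lra.
          + destruct (Nat.eqb_spec (p k) j); [congruence|].
            replace (x k j + - e * 0) with (x k j) by ring. lra.
        - unfold ind. destruct (Nat.eqb (p i) j);
            repeat destruct excluded_middle_informative; simpl; lra. }
      rewrite S_INR in Hn.
      assert (H1 : dot M ones (unit_mx k (p k)) = 1) by (apply dot_unit; [exact Hk|now apply Hp]).
      assert (H2 : rsum M (fun i => rsum M (fun j => INR (ind (0 < y i j)))) + dot M ones (unit_mx k (p k))
         <= rsum M (fun i => rsum M (fun j => INR (ind (0 < x i j))))).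
      { unfold dot. rewrite <- rsum_plus. apply rsum_le; intros i Hi.
        rewrite <- rsum_plus. apply rsum_le; intros j Hj. unfold ones. rewrite Rmult_1_l. auto. }
      lra.
    + exists ((e, perm_mx p) :: l). split; [|split].
      * constructor; [split; [simpl; lra|now apply perm_sched]|exact Hl].
      * simpl. rewrite Hw. ring.
      * intros i j Hi Hj. simpl. change (x i j = comb l i j + e * perm_mx p i j).
        rewrite <- (Hm i j Hi Hj). unfold y. ring.
Qed.

Theorem birkhoff (M : nat) (c : R) (x : mat) : (1 <= M)%nat -> balanced M c x ->
  exists l : list (R * mat), Forall (fun tp => 0 <= fst tp /\ is_sched M (snd tp)) l /\
    wsum l = c /\ meq M x (comb l).
Proof.
  intros HM Hb. apply (birkhoff_aux M (M * M) HM c x Hb).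
  rewrite mult_INR, <- rsum_const. apply rsum_le; intros i _.
  rewrite <- (Rmult_1_r (INR M)), <- rsum_const. apply rsum_le; intros j _.
  unfold ind. destruct excluded_middle_informative; simpl; lra.
Qed.

(** Birkhoff turns [x] into schedules of total weight [c], each of which pairs with [xi] to at most
    1. *)
Lemma dualP_balanced_le (M : nat) (c : R) (xi x : mat) : (1 <= M)%nat ->
  in_dualP M xi -> balanced M c x -> dot M xi x <= c.
Proof.
  intros HM [_ Hxi] Hb. destruct (birkhoff M c x HM Hb) as [l [Hl [<- Hm]]].
  rewrite (dot_ext M xi xi x (comb l) (meq_refl M xi) Hm). clear Hm Hb.
  induction Hl as [|[t s] l [Ht Hs] _ IH].
  - unfold dot, comb; simpl. rewrite rsum_zero; [lra|]. intros; apply rsum_zero; intros; ring.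
  - simpl in *. change (comb ((t, s) :: l)) with (fun i j => comb l i j + t * s i j).
    rewrite dot_lin. specialize (Hxi s Hs).
    assert (t * dot M xi s <= t * 1) by (apply Rmult_le_compat_l; assumption).
    change (dot M xi (comb l) <= wsum l) in IH. change (wsum ((t, s) :: l)) with (wsum l + t). lra.
Qed.

(** * The set Xi(lambda) *)

Definition exchange_eq (M : nat) (x : mat) : Prop :=
  forall i j k l, (i < M)%nat -> (j < M)%nat -> (k < M)%nat -> (l < M)%nat ->
    x i j + x k l = x i l + x k j.

(** [u] is the column in which row 0 is smallest and [v] the excess of row 0 over its minimum, so
    both are nonnegative. *)
Lemma exchange_decomp (M : nat) (x : mat) : (1 <= M)%nat -> mnonneg M x ->
  exchange_eq M x ->
  exists u v : nat -> R, (forall i, (i < M)%nat -> 0 <= u i) /\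
    (forall j, (j < M)%nat -> 0 <= v j) /\ meq M x (fun i j => u i + v j).
Proof.
  intros HM Hx He. destruct (argmin M (fun j => x O j) HM) as [b [Hb Hmin]].
  exists (fun i => x i b), (fun j => x O j - x O b). split; [|split].
  - auto.
  - intros j Hj. specialize (Hmin j Hj). lra.
  - intros i j Hi Hj. specialize (He i j O b Hi Hj HM Hb). lra.
Qed.

(** Two permutations that differ only by exchanging their values at [i] and [k] have equal sums, and
    all other rows cancel. *)
Lemma exchange_of_perm_const (M : nat) (x : mat) (c : R) :
  (forall p, is_perm M p -> dot M x (perm_mx p) = c) ->
  exchange_eq M x.
Proof.
  intros H i j k l Hi Hj Hk Hl.
  destruct (Nat.eq_dec i k) as [->|Hik]; [lra|].
  destruct (Nat.eq_dec j l) as [->|Hjl]; [lra|].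
  destruct (perm_through M i j k l Hi Hj Hk Hl Hik Hjl) as [p [Hp [Hpi Hpk]]].
  assert (Hp' := comp_perm M p (swap i k) Hp (swap_perm M i k Hi Hk)).
  assert (E := H p Hp). rewrite <- (H _ Hp'), !dot_perm in E by assumption.
  set (f := fun m => x m (p m)) in E. set (g := fun m => x m (p (swap i k m))) in E.
  assert (D : rsum M (fun m => f m - g m) =
    rsum M (fun m => if Nat.eqb m i then x m j - x m l else 0) +
    rsum M (fun m => if Nat.eqb m k then x m l - x m j else 0)).
  { rewrite <- rsum_plus. apply rsum_ext. intros m _. unfold f, g, swap.
    destruct (Nat.eqb_spec m i) as [Ei|Ei], (Nat.eqb_spec m k) as [Ek|Ek]; [congruence| | |lra].
    - rewrite Ei, Hpi, Hpk. lra.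
    - rewrite Ek, Hpi, Hpk. lra. }
  rewrite rsum_minus, !rsum_delta in D by assumption. lra.
Qed.

Lemma dot_row_sched (M i : nat) (s : mat) :
  (i < M)%nat -> is_sched M s -> dot M (row_ind i) s = 1.
Proof.
  intros Hi [p [Hp Hs]]. rewrite (dot_ext _ _ _ _ _ (meq_refl M _) Hs), dot_row by exact Hi.
  now apply perm_row_sum.
Qed.

Lemma dot_col_sched (M j : nat) (s : mat) :
  (j < M)%nat -> is_sched M s -> dot M (col_ind j) s = 1.
Proof.
  intros Hj [p [Hp Hs]]. rewrite (dot_ext _ _ _ _ _ (meq_refl M _) Hs), dot_col by exact Hj.
  now apply perm_col_sum.
Qed.

Lemma dot_rank1_sched (M : nat) (u v : nat -> R) (s : mat) : is_sched M s ->
  dot M (fun i j => u i + v j) s = rsum M u + rsum M v.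
Proof.
  intros Hs. rewrite dot_rank1.
  f_equal; apply rsum_ext; intros; [rewrite dot_row_sched|rewrite dot_col_sched];
    try assumption; ring.
Qed.

Lemma ind_nonneg (M : nat) (a : nat) : mnonneg M (row_ind a) /\ mnonneg M (col_ind a).
Proof.
  split; intros i j _ _; unfold row_ind, col_ind; destruct Nat.eqb; lra.
Qed.

Lemma dualP_entry_le_1 (M : nat) (x : mat) (i j : nat) :
  in_dualP M x -> (i < M)%nat -> (j < M)%nat -> x i j <= 1.
Proof.
  intros [Hx Hs] Hi Hj. assert (Hp := swap_perm M i j Hi Hj).
  apply Rle_trans with (2 := Hs _ (perm_sched M _ Hp)). rewrite dot_perm by exact Hp.
  rewrite <- (swap_l i j) at 1. apply (rsum_term_le M (fun m => x m (swap i j m))); [|exact Hi].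
  intros m Hm. apply Hx; [exact Hm|]. now apply Hp.
Qed.

Definition is_01 (M : nat) (x : mat) : Prop :=
  forall i j, (i < M)%nat -> (j < M)%nat -> x i j = 0 \/ x i j = 1.

(** Entries of members of the dual polytope lie in [0,1], where 0 and 1 are extreme. *)
Lemma extreme_01 (M : nat) (x : mat) : in_dualP M x -> is_01 M x -> in_E M x.
Proof.
  intros Hx H01. split; [exact Hx|]. intros a b t Ha Hb Ht E i j Hi Hj.
  specialize (E i j Hi Hj). simpl in E.
  assert (a i j <= 1) by (apply (dualP_entry_le_1 M); assumption).
  assert (b i j <= 1) by (apply (dualP_entry_le_1 M); assumption).
  assert (0 <= a i j) by (apply Ha; assumption). assert (0 <= b i j) by (apply Hb; assumption).
  destruct (H01 i j Hi Hj) as [E0|E1]; [rewrite E0 in E|rewrite E1 in E]; nra.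
Qed.

(** Every position lies on a permutation, along which [x] already sums to 1; a larger [eta] of the
    polytope has no room to exceed [x] there. *)
Lemma Sstar_01 (M : nat) (x : mat) : mnonneg M x -> is_01 M x ->
  (forall s, is_sched M s -> dot M x s = 1) -> in_Sstar M x.
Proof.
  intros Hx H01 Hs. assert (HE : in_E M x).
  { apply extreme_01; [|exact H01]. split; [exact Hx|]. intros s Hsc. rewrite Hs by exact Hsc. lra. }
  split; [exact HE|]. intros eta [[He0 He] _] Hle i j Hi Hj.
  assert (Hp := swap_perm M i j Hi Hj). assert (Hsc := perm_sched M _ Hp).
  specialize (Hs _ Hsc). specialize (He _ Hsc). rewrite dot_perm in Hs, He by exact Hp.
  assert (Ht : eta i (swap i j i) - x i (swap i j i) <=
     rsum M (fun m => eta m (swap i j m) - x m (swap i j m))).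
  { apply (rsum_term_le M (fun m => eta m (swap i j m) - x m (swap i j m))); [|exact Hi].
    intros m Hm. specialize (Hle m (swap i j m) Hm (proj1 Hp m Hm)). lra. }
  rewrite rsum_minus, swap_l in Ht. specialize (Hle i j Hi Hj). lra.
Qed.

Section Switch.
Variables (M : nat) (lam : mat).
Hypothesis HM : (1 <= M)%nat.
Hypothesis Hpos : forall i j, (i < M)%nat -> (j < M)%nat -> 0 < lam i j.
Hypothesis Hrow : forall i, (i < M)%nat -> rsum M (fun j => lam i j) = 1.
Hypothesis Hcol : forall j, (j < M)%nat -> rsum M (fun i => lam i j) = 1.

Lemma lam_balanced : balanced M 1 lam.
Proof. split; [|now split]. intros i j Hi Hj. apply Rlt_le; auto. Qed.

Lemma in_Xi_meq (x y : mat) : meq M x y -> in_Xi M lam x -> in_Xi M lam y.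
Proof.
  intros E [[[[Hx0 Hx] Hext] Hmax] Hl].
  assert (E' : forall i j, (i < M)%nat -> (j < M)%nat -> y i j = x i j)
    by (intros; symmetry; apply E; assumption).
  split; [split; [split; [split|]|]|].
  - intros i j Hi Hj. rewrite E' by assumption. auto.
  - intros s Hs. rewrite (dot_ext M y x s s E' (meq_refl M s)). auto.
  - intros a b t Ha Hb Ht Eab. apply (Hext a b t Ha Hb Ht).
    intros i j Hi Hj. rewrite <- Eab, E' by assumption. reflexivity.
  - intros eta Heta Hle i j Hi Hj. rewrite E' by assumption. apply Hmax; try assumption.
    intros i' j' Hi' Hj'. rewrite <- E' by assumption. auto.
  - now rewrite (dot_ext M y x lam lam E' (meq_refl M lam)).
Qed.

Lemma row_in_Xi (i : nat) : (i < M)%nat -> in_Xi M lam (row_ind i).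
Proof.
  intros Hi. split.
  - apply Sstar_01; [apply ind_nonneg| |intros; now apply dot_row_sched].
    intros a b _ _. unfold row_ind. destruct Nat.eqb; auto.
  - rewrite dot_row by exact Hi. auto.
Qed.

Lemma col_in_Xi (j : nat) : (j < M)%nat -> in_Xi M lam (col_ind j).
Proof.
  intros Hj. split.
  - apply Sstar_01; [apply ind_nonneg| |intros; now apply dot_col_sched].
    intros a b _ _. unfold col_ind. destruct Nat.eqb; auto.
  - rewrite dot_col by exact Hj. auto.
Qed.

(* As [lam > 0], some [lam - e * p] is still balanced, so [xi . p < 1] would give [xi . lam < 1]. *)
Lemma tight_perm (xi : mat) (p : nat -> nat) :
  in_dualP M xi -> dot M xi lam = 1 -> is_perm M p -> dot M xi (perm_mx p) = 1.
Proof.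
  intros Hxi Hl Hp. apply Rle_antisym; [apply Hxi; now apply perm_sched|].
  destruct (pos_lower_bound M (fun i => lam i (p i))) as [e [He Hle]].
  { intros i Hi. apply Hpos; [exact Hi|now apply Hp]. }
  assert (H := dualP_balanced_le M (1 - e) xi _ HM Hxi
    (balanced_sub_perm M 1 e lam p lam_balanced Hp Hle)).
  rewrite dot_lin, Hl in H. nra.
Qed.

(* Peeling off [eta] with its full weight [c] leaves an element of the dual polytope, so
   extremality forces [xi] to be [eta]. *)
Lemma extreme_peel (xi eta : mat) (c : R) :
  in_E M xi -> 0 < c -> in_dualP M eta ->
  (forall s, is_sched M s -> dot M eta s = 1) ->
  (forall s, is_sched M s -> dot M xi s = 1) ->
  mle M (fun i j => c * eta i j) xi -> meq M xi eta.
Proof.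
  intros [Hxi Hext] Hc Heta Heta1 Hxi1 Hle.
  assert (Hsc : is_sched M (perm_mx (fun i => i))) by (apply perm_sched; split; auto).
  assert (Hdot : forall s, is_sched M s -> dot M (fun i j => xi i j + - c * eta i j) s = 1 - c).
  { intros s Hs. rewrite dot_comm, dot_lin, (dot_comm M s xi), (dot_comm M s eta).
    rewrite Heta1, Hxi1 by assumption. ring. }
  assert (Hr0 : mnonneg M (fun i j => xi i j + - c * eta i j)).
  { intros i j Hi Hj. specialize (Hle i j Hi Hj). simpl in *. lra. }
  destruct (Rle_lt_dec 1 c) as [Hc1|Hc1].
  (* Nonnegativity of the sums [1 - c] forces [c = 1]; the remainder then sums to 0 along every
     permutation and vanishes. *)
  - intros i j Hi Hj.
    assert (0 <= eta i j) by (apply Heta; assumption).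
    assert (Hp := swap_perm M i j Hi Hj).
    assert (Hd := Hdot _ (perm_sched M _ Hp)). rewrite dot_perm in Hd by exact Hp.
    assert (Ht : xi i (swap i j i) + - c * eta i (swap i j i) <=
       rsum M (fun m => xi m (swap i j m) + - c * eta m (swap i j m))).
    { apply (rsum_term_le M (fun m => xi m (swap i j m) + - c * eta m (swap i j m))); [|exact Hi].
      intros m Hm. apply Hr0; [exact Hm|now apply Hp]. }
    rewrite swap_l in Ht. specialize (Hr0 i j Hi Hj). simpl in Hr0.
    assert (c = 1).
    { apply Rle_antisym; [|exact Hc1]. apply Rge_le, Rminus_ge, Rle_ge. rewrite <- (Hdot _ Hsc).
      rewrite dot_perm by (split; auto). apply rsum_nonneg. intros m Hm.
      specialize (Hle m m Hm Hm). simpl in Hle. lra. }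
    subst c. lra.
  (* The remainder, rescaled by [1 - c], sums to 1 on each schedule, and [xi] is a convex
     combination of [eta] and [rest]. *)
  - set (rest := fun i j => (xi i j + - c * eta i j) / (1 - c)).
    assert (Hrest : in_dualP M rest).
    { split.
      - intros i j Hi Hj. unfold rest. apply Rmult_le_pos; [auto|].
        apply Rlt_le, Rinv_0_lt_compat. lra.
      - intros s Hs. unfold rest, Rdiv.
        rewrite dot_comm, (dot_ext M s s _ (fun i j => 0 + / (1 - c) * (xi i j + - c * eta i j)) (meq_refl M s))
          by (intros i j _ _; ring).
        rewrite (dot_lin M s (fun _ _ => 0)), (dot_comm M s (fun i j => xi i j + _)), Hdot by exact Hs.
        unfold dot at 1. rewrite rsum_zero by (intros; apply rsum_zero; intros; ring).
        right. field. lra. }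
    assert (E : meq M xi (fun i j => c * eta i j + (1 - c) * rest i j)).
    { intros i j _ _. unfold rest. field. lra. }
    assert (E2 := Hext eta rest c Heta Hrest (conj Hc Hc1) E).
    intros i j Hi Hj. rewrite E, <- E2 by assumption. ring.
Qed.

Lemma Xi_char (xi : mat) : in_Xi M lam xi <->
  (exists i, (i < M)%nat /\ meq M xi (row_ind i)) \/
  (exists j, (j < M)%nat /\ meq M xi (col_ind j)).
Proof.
  assert (Hsym : forall x y, meq M x y -> meq M y x)
    by (intros x y H i j Hi Hj; symmetry; auto).
  split.
  2:{ intros [[i [Hi E]]|[j [Hj E]]]; eapply in_Xi_meq; [| |apply Hsym; exact E|].
      - apply Hsym; exact E.
      - now apply row_in_Xi.
      - now apply col_in_Xi. }
  intros [[HE _] Hl]. assert (Hd := proj1 HE).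
  assert (H1 : forall p, is_perm M p -> dot M xi (perm_mx p) = 1)
    by (intros; now apply tight_perm).
  destruct (exchange_decomp M xi HM (proj1 Hd) (exchange_of_perm_const M xi 1 H1))
    as [u [v [Hu [Hv Huv]]]].
  assert (Hs1 : forall s, is_sched M s -> dot M xi s = 1).
  { intros s [p [Hp Es]]. rewrite (dot_ext M xi xi s _ (meq_refl M xi) Es). auto. }
  (* A positive [u i] makes [xi] dominate [u i] times the row indicator, because the other terms are
     nonnegative; a positive [v j] does the same for columns. *)
  destruct (classic (exists i, (i < M)%nat /\ 0 < u i)) as [[i [Hi Hui]]|Hnu].
  - left. exists i. split; [exact Hi|]. apply (extreme_peel xi _ (u i)); try assumption.
    + apply row_in_Xi; exact Hi.
    + intros; now apply dot_row_sched.
    + intros a b Ha Hb. simpl. rewrite Huv by assumption. specialize (Hu a Ha); specialize (Hv b Hb).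
      unfold row_ind. destruct (Nat.eqb_spec a i) as [->|]; lra.
  - destruct (classic (exists j, (j < M)%nat /\ 0 < v j)) as [[j [Hj Hvj]]|Hnv].
    + right. exists j. split; [exact Hj|]. apply (extreme_peel xi _ (v j)); try assumption.
      * apply col_in_Xi; exact Hj.
      * intros; now apply dot_col_sched.
      * intros a b Ha Hb. simpl. rewrite Huv by assumption. specialize (Hu a Ha); specialize (Hv b Hb).
        unfold col_ind. destruct (Nat.eqb_spec b j) as [->|]; lra.
    (* If all [u] and [v] vanish then [xi] is zero, which contradicts its sum 1 on the identity. *)
    + exfalso. assert (Hid : is_perm M (fun i => i)) by (split; auto).
      specialize (H1 _ Hid). rewrite dot_perm in H1 by exact Hid. rewrite rsum_zero in H1; [lra|].
      intros m Hm. rewrite Huv by assumption. specialize (Hu m Hm); specialize (Hv m Hm).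
      destruct (Rle_lt_dec (u m) 0); [|elim Hnu; eauto].
      destruct (Rle_lt_dec (v m) 0); [|elim Hnv; eauto]. lra.
Qed.

Lemma complete_loading_lam : complete_loading M lam.
Proof.
  split.
  - split; [apply lam_balanced|]. exists lam. split; [|intros i j _ _; lra].
    exact (birkhoff M 1 lam HM lam_balanced).
  - intros m [[s [Hs Hm]] _].
    assert (Em : m = INR M).
    { rewrite <- Hm. transitivity (dot M (fun i j => 1 + 0) s).
      - apply dot_ext; [|apply meq_refl]. intros i j _ _. unfold ones; ring.
      - rewrite (dot_rank1_sched M (fun _ => 1) (fun _ => 0) s Hs), !rsum_const. ring. }
    assert (HMR : 1 <= INR M) by (change 1 with (INR 1); apply le_INR; exact HM).
    (* Row indicators alone give the decomposition: weighted by [1 / m] they add up to the constant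
       matrix, and since [m = INR M] the weights total 1. The sum is built row by row. *)
    assert (Hgen : forall n, (n <= M)%nat -> exists l : list (R * mat),
      Forall (fun tp => 0 <= fst tp /\ in_Xi M lam (snd tp)) l /\ wsum l = INR n * (1 / m) /\
      forall i j, comb l i j = if Nat.ltb i n then 1 / m else 0).
    { induction n as [|n IH]; intros Hn.
      - exists nil. split; [constructor|]. split; [simpl; ring|reflexivity].
      - destruct IH as [l [Hl [Hw Hc]]]; [lia|]. exists ((1 / m, row_ind n) :: l). split; [|split].
        + constructor; [|exact Hl]. split; [|apply row_in_Xi; lia]. simpl.
          apply Rlt_le, Rdiv_lt_0_compat; lra.
        + rewrite S_INR. change (wsum ((1 / m, row_ind n) :: l)) with (wsum l + 1 / m).
          rewrite Hw. ring.
        + intros i j. change (comb l i j + 1 / m * row_ind n i j = if Nat.ltb i (S n) then 1 / m else 0).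
          rewrite Hc. unfold row_ind.
          destruct (Nat.ltb_spec i n), (Nat.ltb_spec i (S n)), (Nat.eqb_spec i n); try lia; ring. }
    destruct (Hgen M (Nat.le_refl M)) as [l [Hl [Hw Hc]]]. exists l. split; [exact Hl|]. split.
    + rewrite Hw, Em. field. lra.
    + intros i j Hi _. rewrite Hc. destruct (Nat.ltb_spec i M); [reflexivity|lia].
Qed.
End Switch.

(** * Convexity of L_alpha and exchange perturbations *)

Lemma rpow_pos (x a : R) : 0 < x -> rpow x a = Rpower x a.
Proof. intros Hx. unfold rpow. destruct (Rle_dec x 0); [lra|reflexivity]. Qed.

Lemma rpow_nonpos (x a : R) : x <= 0 -> rpow x a = 0.
Proof. intros Hx. unfold rpow. destruct (Rle_dec x 0); [reflexivity|lra]. Qed.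

Lemma rpow_gt_0 (x a : R) : 0 < x -> 0 < rpow x a.
Proof. intros Hx. rewrite rpow_pos by exact Hx. apply exp_pos. Qed.

Lemma rpow_nonneg (x a : R) : 0 <= rpow x a.
Proof.
  destruct (Rle_lt_dec x 0) as [H|H]; [rewrite rpow_nonpos by exact H; lra|].
  now apply Rlt_le, rpow_gt_0.
Qed.

Lemma rpow_lt (x y a : R) : 0 < a -> 0 <= x < y -> rpow x a < rpow y a.
Proof.
  intros Ha [Hx Hy]. destruct (Rle_lt_dec x 0) as [H|H].
  - rewrite rpow_nonpos by exact H. apply rpow_gt_0. lra.
  - rewrite !rpow_pos by lra. apply Rlt_Rpower_l; lra.
Qed.

Lemma rpow_le (x y a : R) : 0 < a -> x <= y -> rpow x a <= rpow y a.
Proof.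
  intros Ha Hxy. destruct (Rle_lt_dec x 0) as [H|H].
  - rewrite rpow_nonpos by exact H. apply rpow_nonneg.
  - rewrite !rpow_pos by lra. apply Rle_Rpower_l; lra.
Qed.

Lemma rpow_mult (x y a : R) : 0 <= x -> 0 <= y -> rpow (x * y) a = rpow x a * rpow y a.
Proof.
  intros Hx Hy. destruct (Rle_lt_dec x 0) as [H|H].
  { replace x with 0 by lra. rewrite Rmult_0_l, !(rpow_nonpos 0) by lra. ring. }
  destruct (Rle_lt_dec y 0) as [H'|H'].
  { replace y with 0 by lra. rewrite Rmult_0_r, !(rpow_nonpos 0) by lra. ring. }
  rewrite !rpow_pos by (try apply Rmult_lt_0_compat; assumption).
  symmetry. now apply Rpower_mult_distr.
Qed.

Lemma rpow_1_l (a : R) : rpow 1 a = 1.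
Proof. rewrite rpow_pos by lra. unfold Rpower. now rewrite ln_1, Rmult_0_r, exp_0. Qed.

Lemma rpow_S (x a : R) : 0 < x -> rpow x (1 + a) = x * rpow x a.
Proof. intros Hx. rewrite !rpow_pos, Rpower_plus, Rpower_1 by exact Hx. reflexivity. Qed.

Lemma rpow_continuous (a : R) : 0 < a -> continuity (fun x => rpow x a).
Proof.
  intros Ha x. destruct (Rtotal_order x 0) as [Hx|[->|Hx]].
  - apply (continuity_pt_locally_ext (fun _ => 0) _ (- x)); [lra| |now apply continuity_pt_const].
    intros y Hy. unfold Rdist in Hy. apply Rabs_def2 in Hy. rewrite rpow_nonpos by lra. reflexivity.
  (* At 0, the power stays below [eps] as soon as [y] is below [eps ^ (1/a)]; negative [y] give the
     value 0. *)
  - intros eps Heps. exists (Rpower eps (/ a)). split; [apply exp_pos|].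
    intros y [_ Hy]. simpl in *. unfold Rdist in *.
    rewrite (rpow_nonpos 0), Rminus_0_r in * by lra.
    rewrite Rabs_right by (apply Rle_ge, rpow_nonneg). apply Rabs_def2 in Hy.
    apply Rle_lt_trans with (rpow (Rmax y 0) a); [apply rpow_le; [exact Ha|apply Rmax_l]|].
    replace eps with (rpow (Rpower eps (/ a)) a).
    + apply rpow_lt; [exact Ha|]. split; [apply Rmax_r|].
      apply Rmax_lub_lt; [lra|apply exp_pos].
    + rewrite rpow_pos by apply exp_pos. rewrite Rpower_mult, Rinv_l, Rpower_1 by lra. reflexivity.
  - apply (continuity_pt_locally_ext (fun y => Rpower y a) _ x); [lra| |].
    + intros y Hy. unfold Rdist in Hy. apply Rabs_def2 in Hy. rewrite rpow_pos by lra. reflexivity.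
    + apply derivable_continuous_pt. exists (a * Rpower x (a - 1)). now apply derivable_pt_lim_power.
Qed.

(** Both powers tend to 1 as [a] tends to 0. With [K = B / s] the claim is [a * ln K < ln 2]; the 1
    added to [Rabs (ln K)] avoids a zero denominator. *)
Lemma rpow_ratio_small (B s : R) : 0 < B -> 0 < s ->
  exists a0, 0 < a0 /\ forall a, 0 < a < a0 -> rpow B a < 2 * rpow s a.
Proof.
  intros HB Hs. set (K := B / s). assert (HK : 0 < K) by now apply Rdiv_lt_0_compat.
  assert (Hln2 : 0 < ln 2) by (rewrite <- ln_1; apply ln_increasing; lra).
  assert (HA := Rabs_pos (ln K)). exists (ln 2 / (Rabs (ln K) + 1)).
  split; [apply Rdiv_lt_0_compat; lra|]. intros a [Ha Hlt].
  assert (Hmul : a * (Rabs (ln K) + 1) < ln 2).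
  { apply Rmult_lt_compat_r with (r := Rabs (ln K) + 1) in Hlt; [|lra].
    unfold Rdiv in Hlt. rewrite Rmult_assoc, Rinv_l in Hlt by lra. lra. }
  replace B with (K * s) by (unfold K; field; lra). rewrite rpow_mult by lra.
  apply Rmult_lt_compat_r; [now apply rpow_gt_0|].
  rewrite rpow_pos by exact HK. rewrite <- (exp_ln 2) by lra. apply exp_increasing.
  assert (ln K <= Rabs (ln K)) by apply Rle_abs. nra.
Qed.

(** Strict convexity of [x^(1+a)/(1+a)], whose derivative is [x^a]. Between positive points this is
    the mean value theorem; a zero endpoint is treated directly. *)
Lemma rpow_tangent (a x y : R) : 0 < a -> 0 <= x -> 0 <= y -> x <> y ->
  rpow x (1 + a) / (1 + a) + rpow x a * (y - x) < rpow y (1 + a) / (1 + a).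
Proof.
  intros Ha Hx Hy Hne.
  assert (Hi : 0 < / (1 + a) < 1) by
    (split; [apply Rinv_0_lt_compat; lra|rewrite <- Rinv_1; apply Rinv_lt_contravar; lra]).
  destruct (Req_dec x 0) as [->|Hx0].
  { rewrite !(rpow_nonpos 0) by lra. unfold Rdiv.
    assert (0 < rpow y (1 + a)) by (apply rpow_gt_0; lra). nra. }
  destruct (Req_dec y 0) as [->|Hy0].
  { rewrite (rpow_nonpos 0), rpow_S by lra. unfold Rdiv.
    assert (0 < rpow x a) by (apply rpow_gt_0; lra).
    assert (0 < x * rpow x a) by (apply Rmult_lt_0_compat; lra). nra. }
  assert (Hd : forall c, 0 < c ->
    derivable_pt_lim (fun z => / (1 + a) * Rpower z (1 + a)) c (Rpower c a)).
  { intros c Hc. replace (Rpower c a) with (/ (1 + a) * ((1 + a) * Rpower c (1 + a - 1))).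
    - apply derivable_pt_lim_scal. now apply derivable_pt_lim_power.
    - replace (1 + a - 1) with a by ring. field. lra. }
  rewrite !rpow_pos by lra. unfold Rdiv. rewrite !(Rmult_comm _ (/ (1 + a))).
  destruct (Rtotal_order x y) as [H|[H|H]]; [|congruence|].
  - destruct (MVT_cor2 (fun z => / (1 + a) * Rpower z (1 + a)) (fun c => Rpower c a) x y H) as [c [E Hc]].
    { intros c Hc. apply Hd; lra. }
    assert (Rpower x a < Rpower c a) by (apply Rlt_Rpower_l; lra). simpl in E. nra.
  - destruct (MVT_cor2 (fun z => / (1 + a) * Rpower z (1 + a)) (fun c => Rpower c a) y x H) as [c [E Hc]].
    { intros c Hc. apply Hd; lra. }
    assert (Rpower c a < Rpower x a) by (apply Rlt_Rpower_l; lra). simpl in E. nra.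
Qed.

Lemma rpow_tangent_le (a x y : R) : 0 < a -> 0 <= x -> 0 <= y ->
  rpow x (1 + a) / (1 + a) + rpow x a * (y - x) <= rpow y (1 + a) / (1 + a).
Proof.
  intros Ha Hx Hy. destruct (Req_dec x y) as [->|Hne]; [lra|].
  now apply Rlt_le, rpow_tangent.
Qed.

(** This is the gradient of [Lfun] at nonnegative [q]. *)
Definition grad (a : R) (q : mat) : mat := fun i j => rpow (q i j) a.

Lemma Lfun_tangent (M : nat) (a : R) (q r : mat) : 0 < a -> mnonneg M q -> mnonneg M r ->
  Lfun M a q + dot M (grad a q) (fun i j => r i j + - 1 * q i j) <= Lfun M a r.
Proof.
  intros Ha Hq Hr. unfold Lfun, dot, grad. rewrite <- rsum_plus. apply rsum_le; intros i Hi.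
  rewrite <- rsum_plus. apply rsum_le; intros j Hj.
  assert (H := rpow_tangent_le a (q i j) (r i j) Ha (Hq i j Hi Hj) (Hr i j Hi Hj)). lra.
Qed.

Lemma rsum_eq_of_le (n : nat) (f g : nat -> R) :
  (forall i, (i < n)%nat -> f i <= g i) -> rsum n g <= rsum n f ->
  forall i, (i < n)%nat -> f i = g i.
Proof.
  intros H Hs i Hi.
  assert (Ht : g i - f i <= rsum n (fun i => g i - f i)).
  { apply (rsum_term_le n (fun i => g i - f i)); [|exact Hi]. intros k Hk. specialize (H k Hk). lra. }
  rewrite rsum_minus in Ht. specialize (H i Hi). lra.
Qed.

(** Equality in the tangent inequality forces equality in every entry, where strict convexity
    excludes [r i j <> q i j]. *)
Lemma Lfun_tangent_eq (M : nat) (a : R) (q r : mat) : 0 < a -> mnonneg M q -> mnonneg M r ->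
  Lfun M a r <= Lfun M a q + dot M (grad a q) (fun i j => r i j + - 1 * q i j) -> meq M r q.
Proof.
  intros Ha Hq Hr H i j Hi Hj. apply NNPP; intros Hne.
  assert (Hle : forall i j, (i < M)%nat -> (j < M)%nat ->
    rpow (q i j) (1 + a) / (1 + a) + rpow (q i j) a * (r i j + -1 * q i j) <=
    rpow (r i j) (1 + a) / (1 + a)).
  { intros i' j' Hi' Hj'.
    assert (Ht := rpow_tangent_le a _ _ Ha (Hq i' j' Hi' Hj') (Hr i' j' Hi' Hj')). lra. }
  assert (E0 : Lfun M a q + dot M (grad a q) (fun i j => r i j + - 1 * q i j) =
    rsum M (fun i => rsum M (fun j =>
      rpow (q i j) (1 + a) / (1 + a) + rpow (q i j) a * (r i j + -1 * q i j)))).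
  { unfold Lfun, dot, grad. rewrite <- rsum_plus. apply rsum_ext; intros.
    now rewrite <- rsum_plus. }
  rewrite E0 in H. unfold Lfun in H.
  assert (E := rsum_eq_of_le M _ _
    (fun k Hk => rsum_le M _ _ (fun l Hl => Hle k l Hk Hl)) H i Hi).
  assert (E2 := rsum_eq_of_le M _ _ (fun l Hl => Hle i l Hi Hl) (Req_le _ _ (eq_sym E)) j Hj).
  simpl in E2.
  assert (Hs := rpow_tangent a _ _ Ha (Hq i j Hi Hj) (Hr i j Hi Hj) (not_eq_sym Hne)). lra.
Qed.

(** Margins are row and column sums; two such relations in opposite directions express equal
    margins. *)
Definition marg_ge (M : nat) (r q : mat) : Prop :=
  (forall i, (i < M)%nat -> dot M (row_ind i) q <= dot M (row_ind i) r) /\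
  (forall j, (j < M)%nat -> dot M (col_ind j) q <= dot M (col_ind j) r).

(* The perturbation adds [e] at [(i,j)], [(k,l)] and subtracts [e] at [(i,l)], [(k,j)],
   skipping the subtraction at a vanishing entry. *)
Lemma exchange_perturb (M : nat) (a : R) (q : mat) (i j k l : nat) :
  0 < a -> mnonneg M q -> (i < M)%nat -> (j < M)%nat -> (k < M)%nat -> (l < M)%nat ->
  rpow (q i j) a + rpow (q k l) a < rpow (q i l) a + rpow (q k j) a ->
  exists r, mnonneg M r /\ Lfun M a r < Lfun M a q /\ marg_ge M r q /\
    (0 < q i l -> 0 < q k j -> marg_ge M q r).
Proof.
  intros Ha Hq Hi Hj Hk Hl Hlt.
  assert (Hik : i <> k) by (intros ->; lra). assert (Hjl : j <> l) by (intros ->; lra).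
  (* [h e] is the slope of [Lfun] along the exchange after a step [e]; it is negative at 0 and
     hence, by continuity, for small [e]. *)
  set (h := fun e => rpow (q i j + e) a + rpow (q k l + e) a
                     - (rpow (q i l - e) a + rpow (q k j - e) a)).
  assert (Hcont : forall c d, continuity (fun e => rpow (c + d * e) a)).
  { intros c d x. apply (continuity_pt_comp (fun e => c + d * e) (fun z => rpow z a)).
    - reg.
    - apply rpow_continuous, Ha. }
  assert (Hh : continuity_pt h 0).
  { apply (continuity_pt_locally_ext
      (fun e => rpow (q i j + 1 * e) a + rpow (q k l + 1 * e) a
                - (rpow (q i l + -1 * e) a + rpow (q k j + -1 * e) a)) _ 1); [lra| |].
    - intros y _. unfold h. rewrite !Rmult_1_l.
      replace (q i l + -1 * y) with (q i l - y) by ring.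
      now replace (q k j + -1 * y) with (q k j - y) by ring.
    - apply continuity_pt_minus; apply continuity_pt_plus; apply Hcont. }
  assert (Hh0 : h 0 < 0) by (unfold h; rewrite !Rplus_0_r, !Rminus_0_r; lra).
  destruct (Hh (- h 0)) as [d [Hd Hhd]]; [lra|].
  (* [s1] and [s2] switch off the subtraction at an entry that is already 0. *)
  set (s1 := if Rle_lt_dec (q i l) 0 then 0 else 1).
  set (s2 := if Rle_lt_dec (q k j) 0 then 0 else 1).
  assert (He : exists e, 0 < e < d /\ s1 * e <= q i l /\ s2 * e <= q k j).
  { assert (Hm : forall x y, 0 < x -> 0 <= y -> exists e, 0 < e <= x /\
      (if Rle_lt_dec y 0 then 0 else 1) * e <= y).
    { intros x y Hx Hy. destruct (Rle_lt_dec y 0).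
      - exists x. lra.
      - exists (Rmin x y). assert (0 < Rmin x y) by (apply Rmin_glb_lt; lra).
        assert (Rmin x y <= x) by apply Rmin_l. assert (Rmin x y <= y) by apply Rmin_r. lra. }
    destruct (Hm (d / 2) (q i l)) as [e1 [He1 Hs1]]; [lra|auto|].
    destruct (Hm e1 (q k j)) as [e [He Hs2]]; [lra|auto|].
    exists e. split; [lra|]. split; [|exact Hs2]. fold s1 in Hs1.
    assert (0 <= s1) by (unfold s1; destruct Rle_lt_dec; lra). nra. }
  destruct He as [e [He [Hs1 Hs2]]].
  assert (Hhe : h e < 0).
  { assert (H : Rabs (h e - h 0) < - h 0).
    { apply Hhd. split; [split; [exact I|lra]|]. simpl. unfold Rdist.
      rewrite Rabs_right; lra. }
    apply Rabs_def2 in H. lra. }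
  set (delta := fun x y => 0 + 1 * unit_mx i j x y + 1 * unit_mx k l x y
                           + - s1 * unit_mx i l x y + - s2 * unit_mx k j x y).
  set (r := fun x y => q x y + e * delta x y).
  assert (Hdot : forall x, dot M x delta = x i j + x k l - s1 * x i l - s2 * x k j).
  { intros x. unfold delta.
    rewrite (dot_lin M x (fun x y => 0 + 1 * unit_mx i j x y + 1 * unit_mx k l x y
                           + - s1 * unit_mx i l x y)).
    rewrite (dot_lin M x (fun x y => 0 + 1 * unit_mx i j x y + 1 * unit_mx k l x y)).
    rewrite (dot_lin M x (fun x y => 0 + 1 * unit_mx i j x y)).
    rewrite (dot_lin M x (fun x y => 0)). rewrite !dot_unit by assumption.
    unfold dot at 1. rewrite rsum_zero by (intros; apply rsum_zero; intros; ring). ring. }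
  assert (Hs01 : 0 <= s1 <= 1 /\ 0 <= s2 <= 1)
    by (unfold s1, s2; repeat destruct Rle_lt_dec; lra).
  assert (Hval : r i j = q i j + e /\ r k l = q k l + e /\
                 r i l = q i l - s1 * e /\ r k j = q k j - s2 * e).
  { unfold r, delta, unit_mx. rewrite !Nat.eqb_refl.
    destruct (Nat.eqb_spec i k), (Nat.eqb_spec k i), (Nat.eqb_spec j l), (Nat.eqb_spec l j);
      try congruence. repeat split; ring. }
  assert (Hr : mnonneg M r).
  { intros x y Hx Hy. assert (Hqxy := Hq x y Hx Hy). destruct Hval as [_ [_ [V3 V4]]].
    destruct (classic (x = i /\ y = l)) as [[-> ->]|N1]; [lra|].
    destruct (classic (x = k /\ y = j)) as [[-> ->]|N2]; [lra|].
    assert (U : forall a b, 0 <= unit_mx a b x y /\ (~ (x = a /\ y = b) -> unit_mx a b x y = 0)).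
    { intros c b. unfold unit_mx. destruct (Nat.eqb_spec x c), (Nat.eqb_spec y b);
        split; try lra; tauto. }
    unfold r, delta. rewrite (proj2 (U i l) N1), (proj2 (U k j) N2).
    assert (U1 := proj1 (U i j)). assert (U2 := proj1 (U k l)). nra. }
  (* On a row indicator the raised entries [(i,j)], [(k,l)] are offset by [(i,l)], [(k,j)] in this
     order, on a column indicator by [(k,j)], [(i,l)]. Hence margins never drop, and they are kept
     when nothing is skipped. *)
  assert (Hrow_col : forall x, x i j = x i l /\ x k l = x k j \/ x i j = x k j /\ x k l = x i l ->
     0 <= x i j -> 0 <= x k l -> dot M x q <= dot M x r /\
       (0 < q i l -> 0 < q k j -> dot M x r <= dot M x q)).
  { intros x Hx H1 H2. unfold r. rewrite dot_lin, Hdot.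
    assert (Hp : 0 <= x i j + x k l - s1 * x i l - s2 * x k j)
      by (destruct Hx as [[<- <-]|[<- <-]]; nra).
    split; [nra|]. intros P1 P2. unfold s1, s2.
    destruct (Rle_lt_dec (q i l) 0); [lra|]. destruct (Rle_lt_dec (q k j) 0); [lra|].
    destruct Hx as [[-> ->]|[-> ->]]; lra. }
  assert (Hrows := fun c => Hrow_col (row_ind c) (or_introl (conj eq_refl eq_refl))
    (proj1 (ind_nonneg M c) i j Hi Hj) (proj1 (ind_nonneg M c) k l Hk Hl)).
  assert (Hcols := fun c => Hrow_col (col_ind c) (or_intror (conj eq_refl eq_refl))
    (proj2 (ind_nonneg M c) i j Hi Hj) (proj2 (ind_nonneg M c) k l Hk Hl)).
  exists r. split; [exact Hr|]. split; [|split].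
  (* The tangent is taken at [r], not at [q]: the value at [q] is then at least the value at [r]
     plus [- e * h e], which is positive. *)
  - assert (Ht := Lfun_tangent M a r q Ha Hr Hq).
    assert (Ed : dot M (grad a r) (fun x y => q x y + -1 * r x y) = - e * h e).
    { rewrite (dot_ext M (grad a r) (grad a r) _ (fun x y => 0 + - e * delta x y) (meq_refl M _))
        by (intros x y _ _; unfold r; ring).
      rewrite (dot_lin M (grad a r) (fun _ _ => 0)), Hdot.
      unfold dot. rewrite rsum_zero by (intros; apply rsum_zero; intros; ring).
      unfold grad. destruct Hval as [-> [-> [-> ->]]]. unfold h.
      (* At a skipped entry both sides vanish, since [rpow] is 0 at negative arguments. *)
      assert (Es : forall x, 0 <= x -> (if Rle_lt_dec x 0 then 0 else 1) *
          rpow (x - (if Rle_lt_dec x 0 then 0 else 1) * e) a = rpow (x - e) a).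
      { intros x Hx. destruct (Rle_lt_dec x 0).
        - rewrite (rpow_nonpos (x - e)) by lra. ring.
        - rewrite !Rmult_1_l. reflexivity. }
      unfold s1, s2. rewrite !Es by auto. ring. }
    rewrite Ed in Ht. nra.
  - split; intros c _; [apply Hrows|apply Hcols].
  - intros P1 P2. split; intros c _; [now apply Hrows|now apply Hcols].
Qed.

(** * Invariant states *)

Lemma Un_cv_const (c : R) : Un_cv (fun _ => c) c.
Proof. intros e He. exists O. intros n _. now rewrite Rdist_eq. Qed.

Lemma Un_cv_subseq (u : nat -> R) (l : R) (phi : nat -> nat) :
  (forall n, (n <= phi n)%nat) -> Un_cv u l -> Un_cv (fun n => u (phi n)) l.
Proof.
  intros Hphi H e He. destruct (H e He) as [N HN]. exists N. intros n Hn. apply HN.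
  specialize (Hphi n). lia.
Qed.

Lemma Un_cv_rsum (n : nat) (u : nat -> nat -> R) (l : nat -> R) :
  (forall i, (i < n)%nat -> Un_cv (fun k => u k i) (l i)) ->
  Un_cv (fun k => rsum n (u k)) (rsum n l).
Proof.
  induction n as [|n IH]; intros H; simpl; [apply Un_cv_const|].
  apply CV_plus; [apply IH; auto with arith|apply H; lia].
Qed.

(** One coordinate at a time: a further subsequence is extracted for the new coordinate, and limits
    already found persist. For this the index maps need only satisfy [n <= phi n]. *)
Lemma bolzano_weierstrass_list (A : Type) (s : list A) (x : nat -> A -> R) (B : R) :
  (forall n a, In a s -> 0 <= x n a <= B) ->
  exists phi : nat -> nat, (forall n, (n <= phi n)%nat) /\
    forall a, In a s -> exists l, Un_cv (fun n => x (phi n) a) l.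
Proof.
  induction s as [|a s IH]; intros HB.
  { exists (fun n => n). split; [auto|intros a []]. }
  destruct IH as [phi [Hphi Hs]]; [intros; apply HB; now right|].
  destruct (Bolzano_Weierstrass (fun n => x (phi n) a) _ (compact_P3 0 B)) as [l Hl].
  { intros n. apply HB. now left. }
  assert (Hn : forall n, exists p, (n <= p)%nat /\ Rabs (x (phi p) a - l) < / INR (S n)).
  { intros n. assert (Hp : 0 < / INR (S n)) by apply Rinv_0_lt_compat, lt_0_INR, Nat.lt_0_succ.
    apply (Hl (disc l (mkposreal _ Hp)) n). exists (mkposreal _ Hp). intros y Hy; exact Hy. }
  destruct (choice _ Hn) as [psi Hpsi].
  exists (fun n => phi (psi n)). split.
  { intros n. apply Nat.le_trans with (psi n); [apply Hpsi|apply Hphi]. }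
  intros b [<-|Hb].
  - exists l. intros e He. destruct (archimed_cor1 e He) as [N [HN HN0]]. exists N. intros n Hge.
    apply Rlt_trans with (1 := proj2 (Hpsi n)). apply Rle_lt_trans with (2 := HN).
    apply Rinv_le_contravar; [now apply lt_0_INR|apply le_INR; lia].
  - destruct (Hs b Hb) as [l' Hl']. exists l'.
    apply (Un_cv_subseq (fun n => x (phi n) b)); [intros; apply Hpsi|exact Hl'].
Qed.

(** * Margins, and minimisers of [Lfun] with given margins *)

Lemma marg_ge_refl (M : nat) (q : mat) : marg_ge M q q.
Proof. split; intros; lra. Qed.

Lemma marg_ge_trans (M : nat) (p q r : mat) : marg_ge M p q -> marg_ge M q r -> marg_ge M p r.
Proof.
  intros [H1 H2] [H3 H4]. split; intros k Hk.
  - specialize (H1 k Hk); specialize (H3 k Hk); lra.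
  - specialize (H2 k Hk); specialize (H4 k Hk); lra.
Qed.

(** It bounds every entry of a nonnegative matrix whose margins are at most those of [q], and so
    supplies compactness. *)
Definition total (M : nat) (q : mat) : R := rsum M (fun i => dot M (row_ind i) q).

Lemma entry_le_total (M : nat) (q r : mat) (i j : nat) : mnonneg M q -> mnonneg M r ->
  marg_ge M q r -> (i < M)%nat -> (j < M)%nat -> r i j <= total M q.
Proof.
  intros Hq Hr [Hrows _] Hi Hj. apply Rle_trans with (dot M (row_ind i) r).
  - rewrite dot_row by exact Hi. apply (rsum_term_le M (fun j => r i j)); auto.
  - apply Rle_trans with (1 := Hrows i Hi).
    apply (rsum_term_le M (fun i => dot M (row_ind i) q)); [|exact Hi].
    intros k Hk. rewrite dot_row by exact Hk. apply rsum_nonneg; auto.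
Qed.

Lemma Lfun_nonneg (M : nat) (a : R) (q : mat) : 0 < a -> 0 <= Lfun M a q.
Proof.
  intros Ha. apply rsum_nonneg; intros; apply rsum_nonneg; intros.
  apply Rmult_le_pos; [apply rpow_nonneg|]. apply Rlt_le, Rinv_0_lt_compat; lra.
Qed.

(** A minimising sequence has entries bounded by [total M q0], so a subsequence converges entrywise,
    and the constraints and [Lfun] pass to the limit. *)
Lemma transport_minimizer (M : nat) (a : R) (q0 : mat) : 0 < a -> mnonneg M q0 ->
  exists q, mnonneg M q /\ marg_ge M q q0 /\ marg_ge M q0 q /\
    forall r, mnonneg M r -> marg_ge M r q0 -> marg_ge M q0 r -> Lfun M a q <= Lfun M a r.
Proof.
  intros Ha Hq0.
  set (P := fun r => mnonneg M r /\ marg_ge M r q0 /\ marg_ge M q0 r).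
  (* The supremum [m] is that of [- Lfun], so [- m] is the infimum to be attained. *)
  destruct (completeness (fun z => exists r, P r /\ z = - Lfun M a r)) as [m [Hub Hlub]].
  { exists 0. intros z [r [_ ->]]. assert (H := Lfun_nonneg M a r Ha). lra. }
  { exists (- Lfun M a q0), q0. split; [|reflexivity].
    split; [exact Hq0|split; apply marg_ge_refl]. }
  assert (Hn : forall n, exists r, P r /\ m - / INR (S n) < - Lfun M a r).
  { intros n. apply NNPP; intros Hno.
    assert (Hp : 0 < / INR (S n)) by apply Rinv_0_lt_compat, lt_0_INR, Nat.lt_0_succ.
    assert (m <= m - / INR (S n)); [|lra].
    apply Hlub. intros z [r [Pr ->]]. apply Rnot_lt_le. intros Hlt. apply Hno. exists r; auto. }
  destruct (choice _ Hn) as [r Hr].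
  destruct (bolzano_weierstrass_list (nat * nat) (list_prod (seq 0 M) (seq 0 M))
    (fun n p => r n (fst p) (snd p)) (total M q0)) as [phi [Hphi Hcv]].
  { intros n [i j] Hin. apply in_prod_iff in Hin. rewrite !in_seq in Hin. simpl.
    destruct (Hr n) as [[H0 [_ H1]] _].
    split; [apply H0; lia|apply entry_le_total; auto; lia]. }
  assert (Hcv' : forall p, exists l, In p (list_prod (seq 0 M) (seq 0 M)) ->
     Un_cv (fun n => r (phi n) (fst p) (snd p)) l).
  { intros p. destruct (classic (In p (list_prod (seq 0 M) (seq 0 M)))) as [Hp|Hp].
    - destruct (Hcv p Hp) as [l Hl]. exists l; auto.
    - exists 0. tauto. }
  destruct (choice _ Hcv') as [lim Hlim].
  set (q := fun i j => lim (i, j)).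
  assert (Hq : forall i j, (i < M)%nat -> (j < M)%nat -> Un_cv (fun n => r (phi n) i j) (q i j)).
  { intros i j Hi Hj. apply (Hlim (i, j)). apply in_prod_iff. rewrite !in_seq. lia. }
  assert (Hdot : forall x, Un_cv (fun n => dot M x (r (phi n))) (dot M x q)).
  { intros x. apply (Un_cv_rsum M (fun n i => rsum M (fun j => x i j * r (phi n) i j))). intros i Hi.
    apply (Un_cv_rsum M (fun n j => x i j * r (phi n) i j)). intros j Hj.
    apply CV_mult; [apply Un_cv_const|auto]. }
  assert (HL : Un_cv (fun n => Lfun M a (r (phi n))) (Lfun M a q)).
  { apply (Un_cv_rsum M (fun n i => rsum M (fun j => rpow (r (phi n) i j) (1 + a) / (1 + a)))).
    intros i Hi. apply (Un_cv_rsum M (fun n j => rpow (r (phi n) i j) (1 + a) / (1 + a))).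
    intros j Hj. apply CV_mult; [|apply Un_cv_const].
    apply (continuity_seq (fun z => rpow z (1 + a))); [apply rpow_continuous; lra|auto]. }
  exists q. split; [|split; [|split]].
  - intros i j Hi Hj. apply (@Rle_cv_lim (fun _ => 0) (fun n => r (phi n) i j) _ _).
    + intros n. apply (Hr (phi n)); assumption.
    + apply Un_cv_const.
    + auto.
  - split; intros k Hk.
    + apply (@Rle_cv_lim (fun _ => dot M (row_ind k) q0) (fun n => dot M (row_ind k) (r (phi n))) _ _);
        [intros n; apply (Hr (phi n)); exact Hk|apply Un_cv_const|auto].
    + apply (@Rle_cv_lim (fun _ => dot M (col_ind k) q0) (fun n => dot M (col_ind k) (r (phi n))) _ _);
        [intros n; apply (Hr (phi n)); exact Hk|apply Un_cv_const|auto].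
  - split; intros k Hk.
    + apply (@Rle_cv_lim (fun n => dot M (row_ind k) (r (phi n))) (fun _ => dot M (row_ind k) q0) _ _);
        [intros n; apply (Hr (phi n)); exact Hk|auto|apply Un_cv_const].
    + apply (@Rle_cv_lim (fun n => dot M (col_ind k) (r (phi n))) (fun _ => dot M (col_ind k) q0) _ _);
        [intros n; apply (Hr (phi n)); exact Hk|auto|apply Un_cv_const].
  - intros r' H0 H1 H2. apply Rle_trans with (- m).
    + apply (@Rle_cv_lim (fun n => Lfun M a (r (phi n))) (fun n => - m + / INR (S (phi n))) _ _).
      * intros n. destruct (Hr (phi n)) as [_ H]. lra.
      * exact HL.
      * replace (- m) with (- m + 0) at 1 by ring. apply CV_plus; [apply Un_cv_const|].
        apply (Un_cv_subseq (fun n => / INR (S n)) 0 phi Hphi).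
        intros e He. destruct (archimed_cor1 e He) as [N [HN HN0]]. exists N. intros n Hge.
        unfold Rdist. rewrite Rminus_0_r, Rabs_right
          by (apply Rle_ge, Rlt_le, Rinv_0_lt_compat, lt_0_INR, Nat.lt_0_succ).
        apply Rle_lt_trans with (2 := HN).
        apply Rinv_le_contravar; [now apply lt_0_INR|apply le_INR; lia].
    + assert (- Lfun M a r' <= m); [|lra].
      apply Hub. exists r'. split; [|reflexivity]. split; auto.
Qed.

Section Invariant.
Variables (M : nat) (lam : mat).
Hypothesis HM : (1 <= M)%nat.
Hypothesis Hpos : forall i j, (i < M)%nat -> (j < M)%nat -> 0 < lam i j.
Hypothesis Hrow : forall i, (i < M)%nat -> rsum M (fun j => lam i j) = 1.
Hypothesis Hcol : forall j, (j < M)%nat -> rsum M (fun i => lam i j) = 1.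

(** [Xi_char] turns the workload constraints into row and column constraints, and positivity of
    [lam] settles the third clause. *)
Lemma lift_feasible_iff (q r : mat) :
  lift_feasible M lam q r <-> mnonneg M r /\ marg_ge M r q.
Proof.
  split.
  - intros [H0 [H1 _]]. split; [exact H0|].
    split; intros k Hk; apply Rge_le, H1, Xi_char; try assumption;
      [left|right]; exists k; (split; [exact Hk|apply meq_refl]).
  - intros [H0 [H1 H2]]. split; [exact H0|]. split.
    + intros xi Hxi. apply Rle_ge. apply (Xi_char M lam HM Hpos Hrow Hcol) in Hxi.
      destruct Hxi as [[k [Hk E]]|[k [Hk E]]]; rewrite !(dot_ext M xi _ _ _ E (meq_refl M _)); auto.
    + intros i j Hi Hj E. specialize (Hpos i j Hi Hj). lra.
Qed.

(* Karush-Kuhn-Tucker: [q ^ a = u_i + v_j] with nonnegative multipliers. *)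
Lemma exchange_invariant (a : R) (q : mat) : 0 < a -> mnonneg M q ->
  exchange_eq M (grad a q) -> invariant M a lam q.
Proof.
  intros Ha Hq Hex.
  destruct (exchange_decomp M (grad a q) HM (fun i j _ _ => rpow_nonneg (q i j) a) Hex)
    as [u [v [Hu [Hv Huv]]]].
  assert (Hd : forall r, lift_feasible M lam q r ->
    0 <= dot M (grad a q) (fun i j => r i j + -1 * q i j)).
  { intros r Hr. apply lift_feasible_iff in Hr. destruct Hr as [_ [H1 H2]].
    rewrite (dot_ext M _ _ _ _ Huv (meq_refl M _)), dot_rank1.
    apply Rplus_le_le_0_compat; apply rsum_nonneg; intros k Hk; rewrite dot_lin;
      apply Rmult_le_pos; auto.
    - specialize (H1 k Hk). lra.
    - specialize (H2 k Hk). lra. }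
  split; [exact Hq|]. split; [|split].
  - apply lift_feasible_iff. split; [exact Hq|apply marg_ge_refl].
  - intros r Hr. assert (H := Hd r Hr).
    assert (Ht := Lfun_tangent M a q r Ha Hq (proj1 Hr)). lra.
  - intros r Hr HL. assert (H := Hd r Hr).
    apply (Lfun_tangent_eq M a q r Ha Hq (proj1 Hr)). lra.
Qed.

(** A strict inequality would let [exchange_perturb] produce a feasible matrix with smaller [Lfun];
    interchanging [j] and [l] gives the reverse bound. *)
Lemma invariant_exchange (a : R) (q : mat) : 0 < a ->
  invariant M a lam q -> exchange_eq M (grad a q).
Proof.
  intros Ha [Hq [_ [Hmin _]]].
  assert (H : forall i j k l, (i < M)%nat -> (j < M)%nat -> (k < M)%nat -> (l < M)%nat ->
    grad a q i l + grad a q k j <= grad a q i j + grad a q k l).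
  { intros i j k l Hi Hj Hk Hl. apply Rnot_lt_le. intros Hlt.
    destruct (exchange_perturb M a q i j k l Ha Hq Hi Hj Hk Hl Hlt) as [r [Hr [HL [Hm _]]]].
    assert (Lfun M a q <= Lfun M a r) by (apply Hmin, lift_feasible_iff; auto). lra. }
  intros i j k l Hi Hj Hk Hl. apply Rle_antisym; auto.
Qed.

(* A vanishing entry [(i,j)] could be raised against two entries of size at least [s]; the
   exchange lowers [Lfun] because every [q ^ a] is close to [1] for small [a]. *)
Lemma transport_minimizer_invariant (a s : R) (q0 : mat) : 0 < a -> 0 < s -> mnonneg M q0 ->
  (forall i, (i < M)%nat -> s * INR M <= dot M (row_ind i) q0) ->
  (forall j, (j < M)%nat -> s * INR M <= dot M (col_ind j) q0) ->
  rpow (total M q0) a < 2 * rpow s a ->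
  exists q, invariant M a lam q /\ marg_ge M q q0 /\ marg_ge M q0 q.
Proof.
  intros Ha Hs Hq0 HR HC Hsmall.
  destruct (transport_minimizer M a q0 Ha Hq0) as [q [Hq [H1 [H2 Hmin]]]].
  exists q. split; [|now split].
  assert (HMR : 0 < INR M) by (apply lt_0_INR; lia).
  (* Here the minimum is over exact margins, so only exchanges whose two lowered entries are
     positive can be compared. *)
  assert (Hno : forall i j k l, (i < M)%nat -> (j < M)%nat -> (k < M)%nat -> (l < M)%nat ->
    0 < q i l -> 0 < q k j -> rpow (q i l) a + rpow (q k j) a <= rpow (q i j) a + rpow (q k l) a).
  { intros i j k l Hi Hj Hk Hl P1 P2. apply Rnot_lt_le. intros Hlt.
    destruct (exchange_perturb M a q i j k l Ha Hq Hi Hj Hk Hl Hlt) as [r [Hr [HL [Hm1 Hm2]]]].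
    assert (Lfun M a q <= Lfun M a r); [|lra]. apply Hmin; [exact Hr| |].
    - now apply marg_ge_trans with q.
    - apply marg_ge_trans with q; auto. }
  assert (Hqpos : forall i j, (i < M)%nat -> (j < M)%nat -> 0 < q i j).
  { intros i j Hi Hj. destruct (Rle_lt_dec (q i j) 0) as [Hle|]; [exfalso|assumption].
    destruct (large_term M (fun l => q i l) (s * INR M) HM) as [l [Hl Hil]].
    { rewrite <- dot_row by exact Hi. apply Rle_trans with (1 := HR i Hi). now apply H1. }
    destruct (large_term M (fun k => q k j) (s * INR M) HM) as [k [Hk Hkj]].
    { rewrite <- dot_col by exact Hj. apply Rle_trans with (1 := HC j Hj). now apply H1. }
    assert (Es : s * INR M / INR M = s) by (field; lra). rewrite Es in Hil, Hkj.
    assert (Hx := Hno i j k l Hi Hj Hk Hl ltac:(lra) ltac:(lra)).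
    rewrite (rpow_nonpos (q i j)) in Hx by exact Hle.
    assert (rpow s a <= rpow (q i l) a) by now apply rpow_le.
    assert (rpow s a <= rpow (q k j) a) by now apply rpow_le.
    assert (rpow (q k l) a <= rpow (total M q0) a)
      by (apply rpow_le; [exact Ha|now apply entry_le_total]).
    lra. }
  apply exchange_invariant; [exact Ha|exact Hq|].
  intros i j k l Hi Hj Hk Hl. apply Rle_antisym; apply Hno; auto.
Qed.

(** * The workload map and its cone *)

Lemma Wmap_row (q : mat) (i : nat) : (i < M)%nat -> Wmap M q i = dot M (row_ind i) q.
Proof. intros Hi. unfold Wmap, xi_enum. destruct (Nat.ltb_spec i M); [reflexivity|lia]. Qed.

Lemma Wmap_col (q : mat) (j : nat) : Wmap M q (M + j) = dot M (col_ind j) q.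
Proof.
  unfold Wmap, xi_enum. destruct (Nat.ltb_spec (M + j) M); [lia|].
  now replace (M + j - M)%nat with j by lia.
Qed.

Lemma Wmap_marg (p q : mat) : marg_ge M p q -> marg_ge M q p -> veq (2 * M) (Wmap M p) (Wmap M q).
Proof.
  intros [H1 H2] [H3 H4] k Hk. destruct (le_lt_dec M k) as [Hge|Hlt].
  - replace k with (M + (k - M))%nat by lia. rewrite !Wmap_col.
    apply Rle_antisym; [apply H4|apply H2]; lia.
  - rewrite !Wmap_row by exact Hlt. apply Rle_antisym; auto.
Qed.

Lemma Wmap_ones (k : nat) : (k < 2 * M)%nat -> Wmap M ones k = INR M.
Proof.
  intros Hk. assert (E : rsum M (fun _ => 1) = INR M) by (rewrite rsum_const; ring).
  destruct (le_lt_dec M k) as [Hge|Hlt].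
  - replace k with (M + (k - M))%nat by lia. rewrite Wmap_col, dot_col by lia. exact E.
  - rewrite Wmap_row, dot_row by exact Hlt. exact E.
Qed.

Lemma Wcone_nonneg (w : nat -> R) (k : nat) : Wcone M w -> (k < 2 * M)%nat -> 0 <= w k.
Proof.
  intros [q [Hq Hw]] Hk. rewrite <- Hw by exact Hk. destruct (le_lt_dec M k) as [Hge|Hlt].
  - replace k with (M + (k - M))%nat by lia. rewrite Wmap_col, dot_col by lia.
    apply rsum_nonneg. intros; apply Hq; lia.
  - rewrite Wmap_row, dot_row by exact Hlt. apply rsum_nonneg; auto.
Qed.

(* Otherwise moving slightly away from [Wmap ones] inside the affine hull leaves the cone. *)
Lemma rel_interior_pos (w : nat -> R) (k : nat) :
  rel_interior (2 * M) (Wcone M) w -> (k < 2 * M)%nat -> 0 < w k.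
Proof.
  intros [Hw [eps [Heps Hint]]] Hk.
  destruct (Rle_lt_dec (w k) 0) as [Hle|]; [exfalso|assumption].
  set (o := Wmap M ones).
  set (B := rsum (2 * M) (fun k => Rabs (w k - o k))).
  assert (HB : 0 <= B) by (apply rsum_nonneg; intros; apply Rabs_pos).
  (* This [t] keeps every [t * Rabs (w j - o j)] below [eps], as [B] bounds all the differences. *)
  set (t := eps / (B + 1)).
  assert (Ht : 0 < t) by (apply Rdiv_lt_0_compat; lra).
  assert (HtB : t * (B + 1) = eps) by (unfold t; field; lra).
  set (v := vcomb ((1 + t, w) :: (- t, o) :: nil)).
  assert (Ev : forall j, v j = w j + t * (w j - o j)) by (intros; unfold v, vcomb; simpl; ring).
  assert (HW : Wcone M v).
  { apply Hint.
    - exists ((1 + t, w) :: (- t, o) :: nil). split; [|split].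
      + constructor; [exact Hw|]. constructor; [|constructor]. exists ones. split.
        * intros i j _ _. unfold ones; lra.
        * intros j _; reflexivity.
      + simpl. ring.
      + intros j _; reflexivity.
    - intros j Hj. rewrite Ev. replace (w j + t * (w j - o j) - w j) with (t * (w j - o j)) by ring.
      rewrite Rabs_mult, (Rabs_right t) by lra.
      assert (Rabs (w j - o j) <= B)
        by (apply (rsum_term_le (2 * M) (fun k => Rabs (w k - o k))); [intros; apply Rabs_pos|exact Hj]).
      nra. }
  assert (Hv := Wcone_nonneg v k HW Hk). rewrite Ev in Hv. unfold o in Hv.
  rewrite Wmap_ones in Hv by exact Hk.
  assert (0 < INR M) by (apply lt_0_INR; lia). nra.
Qed.

Lemma rel_interior_Wset (w : nat -> R) : rel_interior (2 * M) (Wcone M) w ->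
  exists alpha0, 0 < alpha0 /\ forall alpha, 0 < alpha < alpha0 -> Wset M lam alpha w.
Proof.
  intros Hw. assert (Hwp := fun k => rel_interior_pos w k Hw).
  destruct Hw as [[q0 [Hq0 Hwq]] _].
  destruct (pos_lower_bound (2 * M) w Hwp) as [m [Hm Hmw]].
  assert (HMR : 0 < INR M) by (apply lt_0_INR; lia).
  assert (Hrows : forall i, (i < M)%nat -> m <= dot M (row_ind i) q0).
  { intros i Hi. rewrite <- Wmap_row, Hwq by lia. apply Hmw; lia. }
  assert (Hcols : forall j, (j < M)%nat -> m <= dot M (col_ind j) q0).
  { intros j Hj. rewrite <- Wmap_col, Hwq by lia. apply Hmw; lia. }
  assert (HB : 0 < total M q0).
  { apply Rlt_le_trans with m; [exact Hm|]. apply Rle_trans with (1 := Hrows O HM).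
    apply (rsum_term_le M (fun i => dot M (row_ind i) q0)); [|exact HM].
    intros i Hi. specialize (Hrows i Hi). lra. }
  (* With [s = m / INR M], the bound [s * INR M] on the margins is exactly [m]. *)
  assert (Hs : 0 < m / INR M) by now apply Rdiv_lt_0_compat.
  destruct (rpow_ratio_small (total M q0) (m / INR M) HB Hs) as [a0 [Ha0 Hsmall]].
  exists a0. split; [exact Ha0|]. intros a Ha.
  assert (Es : m / INR M * INR M = m) by (field; lra).
  destruct (transport_minimizer_invariant a (m / INR M) q0) as [q [Hq [H1 H2]]];
    rewrite ?Es; auto; [lra|].
  exists q. split; [exact Hq|]. intros k Hk. rewrite <- Hwq by exact Hk. now apply Wmap_marg.
Qed.
End Invariant.

(** * Two-by-two switches *)

Lemma rpow_exponent_le (p a b : R) : 0 < a < b -> 0 <= p <= 1 -> rpow p b <= rpow p a.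
Proof.
  intros Hab [H0 H1]. destruct (Rle_lt_dec p 0) as [H|H].
  - rewrite !rpow_nonpos by exact H. lra.
  - rewrite !rpow_pos by exact H. unfold Rpower.
    assert (Hl : ln p <= 0).
    { destruct H1 as [H1| ->]; [|rewrite ln_1; lra]. rewrite <- ln_1.
      apply Rlt_le, ln_increasing; assumption. }
    assert (Hle : b * ln p <= a * ln p) by nra.
    destruct Hle as [Hlt| ->]; [apply Rlt_le, exp_increasing, Hlt|lra].
Qed.

(* The [l^p] quasi-norms decrease in [p]. *)
Lemma rpow_sum_ge_mono (a b x y z : R) : 0 < a < b -> 0 <= x -> 0 <= y -> 0 <= z ->
  rpow z b <= rpow x b + rpow y b -> rpow z a <= rpow x a + rpow y a.
Proof.
  intros Hab Hx Hy Hz H.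
  assert (Nx := rpow_nonneg x a). assert (Ny := rpow_nonneg y a).
  destruct (Rle_lt_dec z x) as [Hzx|Hzx].
  { assert (rpow z a <= rpow x a) by (apply rpow_le; lra). lra. }
  destruct (Rle_lt_dec z y) as [Hzy|Hzy].
  { assert (rpow z a <= rpow y a) by (apply rpow_le; lra). lra. }
  (* Dividing by [z] reduces to ratios in [0,1], whose powers do not decrease as the exponent
     falls. *)
  assert (Hf : forall x, 0 <= x -> x < z -> exists p, 0 <= p <= 1 /\ x = z * p).
  { intros t Ht Htz. exists (t / z).
    assert (E : t = z * (t / z)) by (field; lra).
    split; [|exact E]. split.
    - apply Rmult_le_pos; [exact Ht|apply Rlt_le, Rinv_0_lt_compat; lra].
    - nra. }
  destruct (Hf x Hx Hzx) as [p [Hp ->]]. destruct (Hf y Hy Hzy) as [r [Hr ->]].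
  rewrite !rpow_mult in * by lra.
  assert (Zb : 0 < rpow z b) by (apply rpow_gt_0; lra).
  assert (Za : 0 < rpow z a) by (apply rpow_gt_0; lra).
  assert (1 <= rpow p b + rpow r b) by nra.
  assert (rpow p b <= rpow p a) by now apply rpow_exponent_le.
  assert (rpow r b <= rpow r a) by now apply rpow_exponent_le.
  nra.
Qed.

(** The shift is the smaller of [y] and [z], which then vanishes. If this is [y], then
    [(z - y)^b <= z^b <= x^b + t^b], and [rpow_sum_ge_mono] passes from [b] to [a]. *)
Lemma shift_endpoint (a b x y z t : R) : 0 < a < b ->
  0 <= x -> 0 <= y -> 0 <= z -> 0 <= t ->
  rpow x b + rpow t b = rpow y b + rpow z b ->
  exists s, 0 <= s /\ s <= y /\ s <= z /\
    rpow (y - s) a + rpow (z - s) a <= rpow (x + s) a + rpow (t + s) a.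
Proof.
  assert (Hwlog : forall y z, 0 < a < b -> 0 <= x -> 0 <= y -> 0 <= t -> y <= z ->
    rpow x b + rpow t b = rpow y b + rpow z b ->
    rpow (z - y) a <= rpow (x + y) a + rpow (t + y) a).
  { clear y z. intros y z Hab Hx Hy Ht Hyz E.
    apply (rpow_sum_ge_mono a b); try lra.
    assert (rpow (z - y) b <= rpow z b) by (apply rpow_le; lra).
    assert (rpow x b <= rpow (x + y) b) by (apply rpow_le; lra).
    assert (rpow t b <= rpow (t + y) b) by (apply rpow_le; lra).
    assert (Ny := rpow_nonneg y b). lra. }
  intros Hab Hx Hy Hz Ht E. destruct (Rle_lt_dec y z) as [Hyz|Hyz].
  - exists y. repeat split; try lra. rewrite (rpow_nonpos (y - y)) by lra.
    specialize (Hwlog y z Hab Hx Hy Ht Hyz E). lra.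
  - exists z. repeat split; try lra. rewrite (rpow_nonpos (z - z)) by lra.
    assert (H := Hwlog z y Hab Hx Hz Ht (Rlt_le _ _ Hyz)). lra.
Qed.

(** The shift moves along the segment of matrices with the same margins. [shift_endpoint], applied
    also with the two diagonals exchanged, gives opposite signs at the ends [s1] and [- s0]. *)
Lemma shift_exists (a b x y z t : R) : 0 < a < b ->
  0 <= x -> 0 <= y -> 0 <= z -> 0 <= t ->
  rpow x b + rpow t b = rpow y b + rpow z b ->
  exists s, 0 <= x + s /\ 0 <= y - s /\ 0 <= z - s /\ 0 <= t + s /\
    rpow (x + s) a + rpow (t + s) a = rpow (y - s) a + rpow (z - s) a.
Proof.
  intros Hab Hx Hy Hz Ht E.
  destruct (shift_endpoint a b x y z t Hab Hx Hy Hz Ht E) as [s1 [P1 [P2 [P3 P4]]]].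
  destruct (shift_endpoint a b y x t z Hab Hy Hx Ht Hz (eq_sym E)) as [s0 [Q1 [Q2 [Q3 Q4]]]].
  set (h := fun s => rpow (x + 1 * s) a + rpow (t + 1 * s) a
                     - (rpow (y + -1 * s) a + rpow (z + -1 * s) a)).
  assert (Hcont : forall c d, continuity (fun e => rpow (c + d * e) a)).
  { intros c d u. apply (continuity_pt_comp (fun e => c + d * e) (fun z => rpow z a)).
    - reg.
    - apply rpow_continuous. lra. }
  assert (Hh : continuity h)
    by (intros u; apply continuity_pt_minus; apply continuity_pt_plus; apply Hcont).
  assert (Eh : forall s, h s = rpow (x + s) a + rpow (t + s) a - (rpow (y - s) a + rpow (z - s) a)).
  { intros s. unfold h. rewrite !Rmult_1_l.
    replace (y + -1 * s) with (y - s) by ring. now replace (z + -1 * s) with (z - s) by ring. }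
  destruct (IVT_cor h (- s0) s1 Hh) as [s [Hs Hs0]]; [lra| |].
  - assert (0 <= h s1) by (rewrite Eh; lra).
    assert (h (- s0) <= 0).
    { rewrite Eh. replace (x + - s0) with (x - s0) by ring. replace (t + - s0) with (t - s0) by ring.
      replace (y - - s0) with (y + s0) by ring. replace (z - - s0) with (z + s0) by ring. lra. }
    nra.
  - exists s. rewrite Eh in Hs0. repeat split; lra.
Qed.

Definition mx2 (x y z t : R) : mat :=
  fun i j => match i, j with O, O => x | O, _ => y | _, O => z | _, _ => t end.

Definition veq4 (x y z t : R) (w : nat -> R) : Prop :=
  x + y = w 0%nat /\ z + t = w 1%nat /\ x + z = w 2%nat /\ y + t = w 3%nat.

Lemma Wmap_2 (q : mat) (w : nat -> R) :
  veq 4 (Wmap 2 q) w <-> veq4 (q 0 0)%nat (q 0 1)%nat (q 1 0)%nat (q 1 1)%nat w.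
Proof.
  assert (E : veq4 (q 0 0)%nat (q 0 1)%nat (q 1 0)%nat (q 1 1)%nat (Wmap 2 q)).
  { unfold veq4, Wmap, dot, xi_enum, row_ind, col_ind; simpl. repeat split; ring. }
  destruct E as [E0 [E1 [E2 E3]]]. unfold veq4. rewrite E0, E1, E2, E3. split.
  - intros H. repeat split; apply H; lia.
  - intros [H0 [H1 [H2 H3]]] k Hk. do 4 (destruct k as [|k]; [assumption|]). lia.
Qed.

(** With two rows and two columns, all exchange equations reduce to a single one. *)
Lemma Wset_2 (lam : mat) (a : R) (w : nat -> R) : 0 < a ->
  (forall i j, (i < 2)%nat -> (j < 2)%nat -> 0 < lam i j) ->
  (forall i, (i < 2)%nat -> rsum 2 (fun j => lam i j) = 1) ->
  (forall j, (j < 2)%nat -> rsum 2 (fun i => lam i j) = 1) ->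
  Wset 2 lam a w <-> exists x y z t, 0 <= x /\ 0 <= y /\ 0 <= z /\ 0 <= t /\
    rpow x a + rpow t a = rpow y a + rpow z a /\ veq4 x y z t w.
Proof.
  intros Ha Hpos Hrow Hcol. assert (HM : (1 <= 2)%nat) by lia. split.
  - intros [q [Hq Hw]]. exists (q 0 0)%nat, (q 0 1)%nat, (q 1 0)%nat, (q 1 1)%nat.
    assert (Hq0 := proj1 Hq).
    repeat (split; [apply Hq0; lia|]). split; [|now apply Wmap_2].
    apply (invariant_exchange 2 lam HM Hpos Hrow Hcol a q Ha Hq); lia.
  - intros [x [y [z [t [Hx [Hy [Hz [Ht [E Hw]]]]]]]]]. exists (mx2 x y z t).
    split; [|apply Wmap_2; exact Hw].
    apply exchange_invariant; try assumption.
    + intros i j _ _. destruct i, j; assumption.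
    + intros i j k l _ _ _ _. unfold grad. destruct i, j, k, l; simpl; lra.
Qed.

Theorem theorem8p3 (M : nat) (lam : mat)
  (HM : (1 <= M)%nat)
  (Hpos : forall i j, (i < M)%nat -> (j < M)%nat -> 0 < lam i j)
  (Hrow : forall i, (i < M)%nat -> rsum M (fun j => lam i j) = 1)
  (Hcol : forall j, (j < M)%nat -> rsum M (fun i => lam i j) = 1) :
  complete_loading M lam /\
  (forall xi, in_Xi M lam xi <->
     (exists i, (i < M)%nat /\ meq M xi (row_ind i)) \/
     (exists j, (j < M)%nat /\ meq M xi (col_ind j))) /\
  (forall w, rel_interior (2 * M) (Wcone M) w ->
     exists alpha0, 0 < alpha0 /\
       forall alpha, 0 < alpha < alpha0 -> Wset M lam alpha w) /\
  (M = 2%nat -> forall alpha beta, 0 < alpha < beta ->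
     (forall w, Wset M lam beta w -> Wset M lam alpha w) /\
     (exists w, Wset M lam alpha w /\ ~ Wset M lam beta w)).
Proof.
  split; [now apply complete_loading_lam|].
  split; [intros; now apply Xi_char|].
  split; [intros; now apply rel_interior_Wset|].
  intros -> a b Hab. split.
  - intros w Hw. apply Wset_2 in Hw; try assumption; [|lra].
    destruct Hw as [x [y [z [t [Hx [Hy [Hz [Ht [E Hw]]]]]]]]].
    destruct (shift_exists a b x y z t Hab Hx Hy Hz Ht E) as [s [H1 [H2 [H3 [H4 H5]]]]].
    apply Wset_2; try assumption; [lra|].
    exists (x + s), (y - s), (z - s), (t + s). repeat (split; [assumption|]).
    unfold veq4 in *. lra.
  (* [z ^ a = 2 = 1 ^ a + 1 ^ a], so the exchange equation holds for the exponent [a]. *)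
  - set (z := Rpower 2 (/ a)). assert (Hz : 0 < z) by apply exp_pos.
    exists (Wmap 2 (mx2 1 0 z 1)). split.
    + apply Wset_2; try assumption; [lra|]. exists 1, 0, z, 1.
      repeat (split; [lra|]). split.
      * rewrite rpow_1_l, (rpow_nonpos 0), rpow_pos by lra. unfold z.
        rewrite Rpower_mult, Rinv_l, Rpower_1 by lra. ring.
      * apply (Wmap_2 (mx2 1 0 z 1)). intros k _; reflexivity.
    + intros HW. apply Wset_2 in HW; try assumption; [|lra].
      destruct HW as [x' [y' [z' [t' [Hx [Hy [Hz' [Ht [E Hw]]]]]]]]].
      assert (Hw0 : veq4 1 0 z 1 (Wmap 2 (mx2 1 0 z 1)))
        by (apply (Wmap_2 (mx2 1 0 z 1)); intros k _; reflexivity).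
      unfold veq4 in *.
      (* The margins force [x' <= 1], [t' <= 1] and [z <= z'], so the exponent [b] would need
         [z ^ b <= 2], whereas [z ^ b = 2 ^ (b/a) > 2]. *)
      assert (rpow x' b <= rpow 1 b) by (apply rpow_le; lra).
      assert (rpow t' b <= rpow 1 b) by (apply rpow_le; lra).
      assert (rpow z b <= rpow z' b) by (apply rpow_le; lra).
      rewrite rpow_1_l in *. assert (Ny := rpow_nonneg y' b).
      assert (2 < rpow z b); [|lra].
      rewrite rpow_pos by exact Hz. unfold z. rewrite Rpower_mult.
      rewrite <- (Rpower_1 2) at 1 by lra. apply Rpower_lt; [lra|].
      apply Rmult_lt_reg_l with a; [lra|]. rewrite <- Rmult_assoc, Rinv_r by lra. lra.
Qed.
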